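(* Let $(X,\mathcal{T})$ be a Markov tree on an undirected tree $\mathcal{T}=(V,E)$ with nonnegative components, $X=(X_v)_{v\in V}$. Suppose there exists $u\in V$ such that: (i) for every directed edge $e=(a,b)\in E_u$ there exist a version of the conditional distribution of $X_b$ given $X_a$ and a probability measure $\mu_e$ on $[0,\infty)$ such that the law of $X_b/x_a$ conditionally on $X_a=x_a$ converges weakly to $\mu_e$ as $x_a\to\infty$; (ii) for every edge $e=(a,b)\in E_u$ such that $a\ne u$ and such that there exists an edge $\bar e\in[u\rightsquigarrow a]$ with $\mu_{\bar e}(\{0\})>0$, we have $$\forall \eta>0,\qquad \lim_{\delta\downarrow 0}\ \limsup_{x\to\infty}\ \sup_{\varepsilon\in[0,\delta]}\mathbb{P}(X_b/x>\eta\mid X_a=\varepsilon x)=0 .$$ Let $(M_e: e\in E_u)$ be a vector of independent random variables such that $M_e$ has law $\mu_e$ for every $e\in E_u$. Then, as $t\to\infty$, the conditional law of $X/X_u$ given $X_u=t$ converges weakly to the law of $\Theta_u=(\Theta_{u,v})_{v\in V}$, where $\Theta_{u,u}=1$ and $$\Theta_{u,v}=\prod_{e\in[u\rightsquigarrow v]}M_e,\qquad v\in V\setminus\{u\}.$$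
   Context: Graphs are finite, without self-loops; $V$ has at least two elements and $E\subset V\times V$. A graph is undirected if $(a,b)\in E$ implies $(b,a)\in E$. A path from $u$ to $v$ is a set of edges $\{e_1,\dots,e_n\}\subset E$ with $e_k=(u_{k-1},u_k)$ for distinct nodes $u_0=u,u_1,\dots,u_n=v$. An undirected tree is an undirected graph such that for any two distinct nodes $u,v$ there is a unique path from $u$ to $v$, denoted $[u\rightsquigarrow v]$ (a set of directed edges). For $u\in V$, $E_u\subset E$ denotes the set of edges directed away from $u$: for each pair of edges $(a,b),(b,a)\in E$, $E_u$ contains the one whose first node separates the second node from $u$ (or equals $u$). $(X,\mathcal{T})$ is a Markov tree if it has the global Markov property: whenever $A,B,S\subset V$ are disjoint and non-empty and every path between a node of $A$ and a node of $B$ passes through $S$, the vectors $X_A$ and $X_B$ are conditionally independent given $X_S$, where $X_W=(X_v)_{v\in W}$. Versions of conditional laws: the conditional probabilities in (ii) are computed with the versions of the conditional distributions (Markov kernels) from (i), and the conditional law of $X$ given $X_u=t$ is the version obtained by starting from $X_u=t$ and composing these kernels along the edges of $E_u$ (conditionally independent across branches, by the Markov property). *)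

(* Defs.v *)
From HB Require Import structures.
From mathcomp Require Import all_boot all_order all_algebra.
From mathcomp Require Import all_classical all_reals all_analysis.

Set Implicit Arguments.
Unset Strict Implicit.
Unset Printing Implicit Defensive.

Import Order.TTheory GRing.Theory Num.Theory.
Import numFieldNormedType.Exports measurable_realfun.

Local Open Scope classical_set_scope.
Local Open Scope ring_scope.

Section trees.
Variable V : finType.
Implicit Types (E : {set V * V}) (u v a b : V) (p : seq V).

Definition simple_path E u v p : bool :=
  [&& path (fun a b => (a, b) \in E) u p, uniq (u :: p) & last u p == v].

Definition path_edges u p : {set V * V} := [set e in zip (u :: p) p].

(* A path is the set of its directed edges; the node sequence of such a path is
   u :: p. The only path from u to u is the empty one. *)
Definition is_path E u v (S : {set V * V}) : Prop :=
  exists2 p, simple_path E u v p & S = path_edges u p.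

Definition undirected_tree E : Prop :=
  [/\ (1 < #|V|)%N,
      forall a, (a, a) \notin E,
      forall a b, (a, b) \in E -> (b, a) \in E &
      forall u v, u != v -> exists! S, is_path E u v S].

Definition tree_path E u v : {set V * V} := xget finset.set0 (is_path E u v).

Definition separates E (S A B : {set V}) : Prop :=
  forall a b p, a \in A -> b \in B -> simple_path E a b p ->
  exists2 s, s \in S & s \in a :: p.

Definition edges_from E u : {set V * V} :=
  [set e in E | (e.1 == u)
     || `[< separates E [set e.1]%SET [set e.2]%SET [set u]%SET >] ].

(* The edges directed away from u, by increasing distance of their end node to
   u, so that the edge entering a node precedes the edges leaving it. *)
Definition ordered_edges_from E u : seq (V * V) :=
  sort (fun e f => #|tree_path E u e.2| <= #|tree_path E u f.2|)%N
    (enum (edges_from E u)).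

End trees.

(* sigma-algebra generated by the subfamily of the X v for v in W *)
Definition sigma_of (T I : Type) d (Y : measurableType d) (X : I -> T -> Y)
    (W : set I) : set_system T :=
  <<s \bigcup_(v in W) preimage_set_system setT (X v) measurable >>.

(* R^V with the product topology and the product sigma-algebra *)
Definition rvec (V : finType) (R : realType) : Type := V -> R.

Definition rvec_display : measure_display. Proof. exact: default_measure_display. Qed.

Section rvec_instances.
Variables (V : finType) (R : realType).

HB.instance Definition _ := Topological.copy (rvec V R)
  (prod_topology (fun _ : V => (R : topologicalType))).
HB.instance Definition _ := isPointed.Build (rvec V R) (fun=> 0).

Let coord (v : V) (x : rvec V R) : R := x v.

Let rvec_set0 : sigma_of coord setT set0.
Proof. exact: sigma_algebra0. Qed.

Let rvec_setC A : sigma_of coord setT A -> sigma_of coord setT (~` A).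
Proof. exact: sigma_algebraC. Qed.

Let rvec_bigcup (F : (set (rvec V R))^nat) :
  (forall i, sigma_of coord setT (F i)) ->
  sigma_of coord setT (\bigcup_i (F i)).
Proof. exact: sigma_algebra_bigcup. Qed.

HB.instance Definition _ := @isMeasurable.Build rvec_display (rvec V R)
  (sigma_of coord setT) rvec_set0 rvec_setC rvec_bigcup.

Lemma measurable_coord (v : V) :
  measurable_fun setT (fun x : rvec V R => x v).
Proof.
move=> _ B mB; rewrite setTI; apply: sub_sigma_algebra.
by exists v => //; exists B => //; rewrite setTI.
Qed.

Lemma measurable_rvec d (T : measurableType d) (f : T -> rvec V R) :
  (forall v, measurable_fun setT (fun t => f t v)) -> measurable_fun setT f.
Proof.
move=> mf; apply: (@measurability _ _ _ _ setT f
  (\bigcup_(v in setT) preimage_set_system setT (coord v) measurable)) => //.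
move=> _ [_ [v _ [B mB <-]] <-].
by have := mf v measurableT B mB; rewrite !setTI.
Qed.

End rvec_instances.

#[short(type="topMeasurableType")]
HB.structure Definition TopologicalMeasurable d :=
  {T of Measurable d T & PointedTopological T}.

HB.instance Definition _ (R : realType) := Measurable.on R.
HB.instance Definition _ (V : finType) (R : realType) :=
  Measurable.on (rvec V R).

Definition weak_cvg (R : realType) d (T : topMeasurableType d) (I : Type)
    (mu : I -> set T -> \bar R) (F : set_system I) (nu : set T -> \bar R) :=
  forall f : T -> R, continuous f -> bounded_fun f ->
    (\int[mu i]_x (f x)%:E)%E @[i --> F] --> (\int[nu]_x (f x)%:E)%E.

Section probability.
Context d (T : measurableType d) (R : realType) (P : probability T R).
Local Open Scope ereal_scope.

(* The kernel K is a version of the conditional distribution of Y given Z. *)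
Definition cond_dist d1 d2 (T1 : measurableType d1) (T2 : measurableType d2)
    (Z : T -> T1) (Y : T -> T2) (K : R.-pker T1 ~> T2) : Prop :=
  forall A B, measurable A -> measurable B ->
    P (Z @^-1` A `&` Y @^-1` B) = \int[P]_(w in Z @^-1` A) K (Z w) B.

(* The random variable p is a version of the conditional probability of the
   event F given the sub-sigma-algebra G. *)
Definition cond_prob (G : set_system T) (F : set T) (p : T -> R) : Prop :=
  [/\ forall B, measurable B -> G (p @^-1` B),
      P.-integrable setT (EFin \o p) &
      forall D, G D -> \int[P]_(w in D) (p w)%:E = P (F `&` D)].

(* P(F1 /\ F2 | H) = P(F1 | H) P(F2 | H) almost surely. As versions exist and
   are almost surely unique, it does not matter that these are existential. *)
Definition cond_indep (G1 G2 H : set_system T) : Prop :=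
  forall F1 F2, G1 F1 -> G2 F2 ->
  exists p1 p2 : T -> R, [/\ cond_prob H F1 p1, cond_prob H F2 p2 &
    cond_prob H (F1 `&` F2) (fun w => p1 w * p2 w)%R].

Definition markov_tree (V : finType) (E : {set V * V})
    (X : V -> {RV P >-> R}) : Prop :=
  undirected_tree E /\
  forall A B S : {set V},
    A != finset.set0 -> B != finset.set0 -> S != finset.set0 ->
    [disjoint A & B]%B -> [disjoint A & S]%B -> [disjoint B & S]%B ->
    separates E S A B ->
    cond_indep (sigma_of X [set` A]) (sigma_of X [set` B])
      (sigma_of X [set` S]).

Definition mutually_independent (I : finType) (D : {set I})
    (M : I -> {RV P >-> R}) : Prop :=
  forall J : {set I}, J \subset D ->
  forall B : I -> set R, (forall i, measurable (B i)) ->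
    P (\bigcap_(i in [set` J]) M i @^-1` B i) =
    (\prod_(i in J) fine (P (M i @^-1` B i)))%:E.

End probability.

Section pcomp.
Context d0 d1 d2 (T0 : measurableType d0) (T1 : measurableType d1)
  (T2 : measurableType d2) (R : realType).
Variables (k1 : R.-pker T0 ~> T1) (k2 : R.-pker T1 ~> T2).

Definition pcomp : T0 -> {measure set T2 -> \bar R} := mkcomp_noparam k1 k2.

HB.instance Definition _ := Kernel.on pcomp.

Let pcomp_prob x : pcomp x setT = 1%E.
Proof.
rewrite /pcomp /mkcomp_noparam /= /kcomp_noparam.
under eq_integral do rewrite prob_kernel.
by rewrite integral_cst// mul1e prob_kernel.
Qed.

HB.instance Definition _ :=
  Kernel_isProbability.Build _ _ _ _ _ pcomp pcomp_prob.

End pcomp.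

Section kernels.
Variables (V : finType) (R : realType).
Implicit Types (x : rvec V R) (a b : V).

Definition upd x b (y : R) : rvec V R := fun v => if v == b then y else x v.

Lemma measurable_upd b :
  measurable_fun setT (fun z : rvec V R * R => upd z.1 b z.2).
Proof.
apply: measurable_rvec => v; rewrite /upd; case: (v == b).
  exact: measurable_snd.
exact: measurableT_comp (measurable_coord v) measurable_fst.
Qed.

Lemma measurable_updr x b : measurable_fun setT (upd x b).
Proof.
apply: measurable_rvec => v; rewrite /upd; case: (v == b).
  exact: measurable_id.
exact: measurable_cst.
Qed.

Section coord_kernel.
Variables (k : R.-pker R ~> R) (a : V).

Definition coord_kernel x : {measure set R -> \bar R} := k (x a).

Let measurable_coord_kernel U : measurable U ->
  measurable_fun setT (coord_kernel ^~ U).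
Proof.
move=> mU; exact: (measurableT_comp (measurable_kernel k U mU)
  (measurable_coord a)).
Qed.

HB.instance Definition _ :=
  isKernel.Build _ _ _ _ _ coord_kernel measurable_coord_kernel.

Let coord_kernel_prob x : coord_kernel x setT = 1%E.
Proof. exact: prob_kernel. Qed.

HB.instance Definition _ :=
  Kernel_isProbability.Build _ _ _ _ _ coord_kernel coord_kernel_prob.

End coord_kernel.

Section edge_kernel.
Variables (k : R.-pker R ~> R) (a b : V).

(* the law of x with its b-coordinate replaced by a draw from k (x a) *)
Definition edge_kernel_fun x : set (rvec V R) -> \bar R :=
  pushforward (k (x a)) (upd x b).

Let edge_kernel0 x : edge_kernel_fun x set0 = 0%E.
Proof. by rewrite /edge_kernel_fun /pushforward preimage_set0 measure0. Qed.

Let edge_kernel_ge0 x A : (0 <= edge_kernel_fun x A)%E.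
Proof. by rewrite /edge_kernel_fun /pushforward measure_ge0. Qed.

Let edge_kernel_sigma_additive x : semi_sigma_additive (edge_kernel_fun x).
Proof.
move=> F mF tF mUF; rewrite /edge_kernel_fun /pushforward preimage_bigcup.
have mupd B : measurable B -> measurable (upd x b @^-1` B).
  by move=> mB; rewrite -[X in measurable X]setTI; exact: measurable_updr.
apply: measure_semi_sigma_additive.
- by move=> n; exact: mupd.
- apply/trivIsetP => i j _ _ ij; rewrite -preimage_setI.
  by move/trivIsetP : tF => /(_ _ _ _ _ ij) ->//; rewrite preimage_set0.
- by rewrite -preimage_bigcup; exact: mupd.
Qed.

HB.instance Definition _ x := isMeasure.Build _ _ _ (edge_kernel_fun x)
  (edge_kernel0 x) (edge_kernel_ge0 x) (@edge_kernel_sigma_additive x).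

Definition edge_kernel : rvec V R -> {measure set (rvec V R) -> \bar R} :=
  edge_kernel_fun.

Let measurable_edge_kernel U : measurable U ->
  measurable_fun setT (edge_kernel ^~ U).
Proof.
move=> mU; pose A := (fun z : rvec V R * R => upd z.1 b z.2) @^-1` U.
rewrite (_ : _ ^~ U = fun x => coord_kernel k a x (xsection A x)).
  apply: measurable_fun_xsection_finite_kernel; rewrite inE /A.
  by rewrite -[X in measurable X]setTI; exact: measurable_upd.
by apply/funext => x; congr (k (x a) _); rewrite /A xsectionE.
Qed.

HB.instance Definition _ :=
  isKernel.Build _ _ _ _ _ edge_kernel measurable_edge_kernel.

Let edge_kernel_prob x : edge_kernel x setT = 1%E.
Proof. by rewrite /edge_kernel/= /edge_kernel_fun /pushforward preimage_setT prob_kernel. Qed.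

HB.instance Definition _ :=
  Kernel_isProbability.Build _ _ _ _ _ edge_kernel edge_kernel_prob.

End edge_kernel.

Variable K : V * V -> R.-pker R ~> R.

Fixpoint edges_kernel (s : seq (V * V)) : R.-pker rvec V R ~> rvec V R :=
  if s is e :: s' then pcomp (edge_kernel (K e) e.1 e.2) (edges_kernel s')
  else kdirac (@measurable_id _ _ setT).

Lemma measurable_constant :
  measurable_fun setT ((fun t => (fun=> t)) : R -> rvec V R).
Proof. by apply: measurable_rvec => v; exact: measurable_id. Qed.

(* The law of X given X u = t: starting from X u = t, the remaining coordinates
   are drawn from the kernels K e, following the edges e directed away from u.
   The other initial values are irrelevant, as each of them is overwritten
   before it is used. *)
Definition cond_law (E : {set V * V}) (u : V) : R.-pker R ~> rvec V R :=
  pcomp (kdirac measurable_constant) (edges_kernel (ordered_edges_from E u)).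

End kernels.

Section limit.
Context d (T : measurableType d) (R : realType) (Q : probability T R).

Definition theta (V : finType) (E : {set V * V}) (u : V)
    (M : V * V -> {RV Q >-> R}) (w : T) : rvec V R :=
  fun v => if v == u then 1 else \prod_(e in tree_path E u v) M e w.

End limit.

(* Main.v *)
(* Conditionally on X u = t, the tree is generated by composing the kernels K e
   along the edges directed away from u, because the Markov property gives
   P(X_W in A, X_b in B) = E[K (a, b) (X_a) B; X_W in A] for every connected set
   W of nodes and every edge (a, b) leaving it.

   By backward induction over the edges, ordered by distance to u, the
   conditional expectation of a bounded, scale invariant F, continuous where
   x u <> 0, given that the coordinates drawn so far equal t * w, converges as
   t -> +oo and w -> z to the same expectation for the chain whose kernels are
   x |-> law of x * M_e. If z a <> 0, the step along (a, b) combines (i) with the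
   induction hypothesis in an extended continuous mapping theorem; if z a = 0,
   condition (ii) forces X_b / t to be close to 0, which is also the only value
   that the limit chain can take at b. A node a at which theta is almost surely
   positive can be assumed to have z a <> 0, because the exceptional set has
   measure 0 under the limit kernel, so (ii) is only needed at the other nodes.
   The limit chain started at 1 is theta. *)

Require Import Defs.
From HB Require Import structures.
From mathcomp Require Import all_boot all_order all_algebra.
From mathcomp Require Import all_classical all_reals all_analysis.
From mathcomp Require Import ring lra.
Import Order.TTheory GRing.Theory Num.Theory.
Import numFieldNormedType.Exports measurable_realfun.
Local Open Scope classical_set_scope.
Local Open Scope ring_scope.

Set Implicit Arguments.
Unset Strict Implicit.
Unset Printing Implicit Defensive.

(** * Paths in a tree *)

Section tree_paths.
Variables (V : finType) (E : {set V * V}).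
Implicit Types (u v w a b : V) (p q : seq V) (e : V * V).

(** The convergence is joint in [t] and [w] because the state from which an edge starts is itself a
    random draw that moves with [t]; pointwise convergence in the state would not pass through
    integrals against weakly converging laws. Scale invariance of [F] absorbs the division by [X u]:
    only vectors [t * w] occur, and [t] disappears once all edges have been followed. The obstacle
    is a coordinate [z a = 0]: the starting value [t * w a] then need not tend to infinity, and (i)
    is silent. Such [z] cannot be avoided once some [mu e] has an atom at 0, and where (ii) is not
    assumed they have to be excluded. The excluded set is null for the limit law only, not for the
    laws converging to it, so a cutoff must control the prelimit mass near it. [X] and [theta] are
    reduced to compositions of kernels by the same lemma, whose input is a one-step property;
    connectedness of the reached set provides it for [X], independence of the factors [M e] for
    [theta]. *)

Lemma path_edges0 u : path_edges u [::] = finset.set0.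
Proof. by apply/setP => e; rewrite !inE. Qed.

Lemma path_edges_cons u v p : path_edges u (v :: p) = (u, v) |: path_edges v p.
Proof. by apply/setP => e; rewrite !inE. Qed.

Lemma path_edges_rcons u p v :
  path_edges u (rcons p v) = (last u p, v) |: path_edges u p.
Proof.
elim: p u => [|w p IH] u /=; first by rewrite path_edges_cons path_edges0.
by rewrite !path_edges_cons IH finset.setUCA.
Qed.

Lemma path_edges_nodes u p e : e \in path_edges u p -> e.1 \in u :: p /\ e.2 \in p.
Proof.
elim: p u => [|w p IH] u; first by rewrite path_edges0 inE.
rewrite path_edges_cons finset.in_setU1 => /orP[/eqP -> /=|/IH].
  by rewrite !inE !eqxx.
by rewrite !inE => -[/orP[->|->] ->]; rewrite ?orbT.
Qed.

Lemma path_edges_sub u p : path (fun a b => (a, b) \in E) u p ->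
  path_edges u p \subset E.
Proof.
elim: p u => [|w p IH] u /=; first by rewrite path_edges0 finset.sub0set.
by case/andP=> uw /IH pE; rewrite path_edges_cons finset.subUset finset.sub1set uw.
Qed.

Lemma path_edges_inj u p e e' : uniq (u :: p) ->
  e \in path_edges u p -> e' \in path_edges u p -> e.2 = e'.2 -> e = e'.
Proof.
elim: p u => [|w p IH] u; first by rewrite path_edges0 inE.
rewrite cons_uniq => /andP[_ uwp]; rewrite path_edges_cons !finset.in_setU1.
have wp : w \notin p by case/andP: uwp.
move=> /orP[/eqP ->|ep] /orP[/eqP ->|e'p] //= ee'.
- by have [_] := path_edges_nodes e'p; rewrite -ee' (negPf wp).
- by have [_] := path_edges_nodes ep; rewrite ee' (negPf wp).
- exact: IH _ uwp ep e'p ee'.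
Qed.

Hypothesis treeE : undirected_tree E.

Let symE a b : (a, b) \in E -> (b, a) \in E.
Proof. by case: treeE => _ _ + _; apply. Qed.

Let neqE a b : (a, b) \in E -> a != b.
Proof.
move=> abE; apply/eqP => ab; case: treeE => _ /(_ a)/negP + _ _; apply.
by rewrite {2}ab.
Qed.

Lemma simple_path_rev u v p : simple_path E u v p ->
  simple_path E v u (rev (belast u p)).
Proof.
case/and3P=> pE Up /eqP pv; apply/and3P; split.
- rewrite -pv rev_path; apply: sub_path pE => a b; exact: symE.
- by rewrite -pv -rev_rcons -lastI rev_uniq.
- case: p {pE Up} pv => [//= <- //|w p _ /=].
  by rewrite rev_cons last_rcons.
Qed.

(** [undirected_tree] asserts uniqueness for distinct end nodes. If [u = v], a nonempty node
    sequence would return to its start, against [uniq]. *)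
Lemma simple_path_edges u v p : simple_path E u v p ->
  path_edges u p = tree_path E u v.
Proof.
move=> up; have uSp : is_path E u v (path_edges u p) by exists p.
have := xgetPex finset.set0 (ex_intro _ _ uSp).
rewrite -/(tree_path E u v); have [uv|uv] := eqVneq u v.
  move: up => /and3P[_]; rewrite -uv => + /eqP; case: p {uSp} => [_ _|w p /=].
    case=> q /and3P[_ + /eqP]; case: q => [_ _ ->//|w q /=].
    by move=> /andP[+ _] qu; rewrite -[X in X \notin _]qu mem_last.
  by move=> /andP[+ _] qu; rewrite -[X in X \notin _]qu mem_last.
case: treeE => _ _ _ /(_ _ _ uv)[S [_ US]] uS.
by rewrite -(US _ uSp) (US _ uS).
Qed.

Lemma simple_path_ex u v : exists p, simple_path E u v p.
Proof.
have [<-|uv] := eqVneq u v.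
  by exists [::]; apply/and3P; split.
by case: treeE => _ _ _ /(_ _ _ uv)[S [[p up _] _]]; exists p.
Qed.

Lemma tree_path_refl u : tree_path E u u = finset.set0.
Proof.
by rewrite -(@simple_path_edges u u [::]) ?path_edges0 //; apply/and3P; split.
Qed.

Lemma tree_path_edge u v e : e \in tree_path E u v -> e \in E /\ e.2 != u.
Proof.
have [p up] := simple_path_ex u v; rewrite -(simple_path_edges up) => ep.
case/and3P: up => pE /andP[up _] _; split.
  exact: (fintype.subsetP (path_edges_sub pE)).
by apply: contraNneq up => <-; have [] := path_edges_nodes ep.
Qed.

Lemma simple_path_take u v p w : simple_path E u v p -> w \in u :: p ->
  exists2 q, simple_path E u w q & exists r, p = q ++ r.
Proof.
case/and3P=> pE Up _ wp; have [p1 p2 wE] : exists2 p1, exists p2, p = p1 ++ p2 & last u p1 = w.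
  by case/splitPl: wp => p1 p2 <-; exists p1 => //; exists p2.
case: p2 wE pE Up => r -> <-; rewrite cat_path -cat_cons cat_uniq.
move=> /andP[p1E _] /and3P[Up1 _ _]; exists p1; last by exists r.
by apply/and3P; split.
Qed.

Lemma edges_fromP u e : reflect
  (e \in E /\ forall p, simple_path E e.2 u p -> e.1 \in e.2 :: p)
  (e \in edges_from E u).
Proof.
rewrite inE; apply: (iffP andP) => -[eE eP]; split => //.
  move=> p ep; case/orP: eP => [/eqP ->|/asboolP sep].
    by case/and3P: ep => _ _ /eqP <-; exact: mem_last.
  by have [||s] := sep e.2 u p _ _ ep; rewrite ?inE ?eqxx // => /eqP ->.
apply/orP; right; apply/asboolP => a b p; rewrite !inE => /eqP -> /eqP -> ep.
by exists e.1; [rewrite inE|exact: eP].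
Qed.

(** Separation puts [e.1] on the path from [u] to [e.2]. Cutting that path at [e.1] and appending
    [e.2] gives a simple path again, and uniqueness of paths identifies the edge sets. *)
Lemma tree_path_edges_from u e : e \in edges_from E u ->
  tree_path E u e.2 = e |: tree_path E u e.1 /\ e \notin tree_path E u e.1.
Proof.
case: e => a b /edges_fromP[/= abE abu].
have [p up] := simple_path_ex u b.
have ap : a \in u :: p.
  have := abu _ (simple_path_rev up).
  case/and3P: up => _ _ /eqP pb.
  by rewrite -[X in X :: rev _]pb -rev_rcons -lastI mem_rev.
have [q uq [r pE]] := simple_path_take up ap.
have bq : b \notin u :: q.
  case/and3P: up => _; rewrite {}pE last_cat.
  have qa : last u q = a by case/and3P: uq => _ _ /eqP.
  rewrite qa -cat_cons cat_uniq => /and3P[_ qr _] /eqP rb.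
  case: r qr rb => [_ /= ab|c r qr rb].
    by have := neqE abE; rewrite ab eqxx.
  by move/hasPn : qr => /(_ b); apply; rewrite -rb /= mem_last.
have uqb : simple_path E u b (rcons q b).
  case/and3P: uq => qE Uq /eqP qa; apply/and3P; split.
  - by rewrite rcons_path qE qa.
  - by rewrite -rcons_cons rcons_uniq bq.
  - by rewrite last_rcons.
rewrite -(simple_path_edges uqb) path_edges_rcons -(simple_path_edges uq).
have -> : last u q = a by case/and3P: uq => _ _ /eqP.
split=> //; apply: contra bq => /path_edges_nodes[_ /= bq].
by rewrite inE bq orbT.
Qed.

(** Both edges lie on the path from [u] to their common end, and a simple path enters a node
    once. *)
Lemma edges_from_inj u e e' : e \in edges_from E u -> e' \in edges_from E u ->
  e.2 = e'.2 -> e = e'.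
Proof.
move=> eu e'u ee'; have [p up] := simple_path_ex u e.2.
have [et _] := tree_path_edges_from eu; have [e't _] := tree_path_edges_from e'u.
have /and3P[_ Up _] := up; apply: (path_edges_inj Up) => //.
  by rewrite (simple_path_edges up) et !inE eqxx.
by rewrite (simple_path_edges up) ee' e't !inE eqxx.
Qed.

Lemma edges_from_target u e : e \in edges_from E u -> e.2 != u.
Proof.
move=> /tree_path_edges_from[et _]; suff /tree_path_edge[] : e \in tree_path E u e.2 by [].
by rewrite et !inE eqxx.
Qed.

Lemma edges_from_ex u v : v != u -> exists2 e, e \in edges_from E u & e.2 = v.
Proof.
move=> vu; have [p up] := simple_path_ex u v.
case/lastP: p up => [/and3P[_ _ /eqP /= uv]|p w up].
  by rewrite uv eqxx in vu.
have wv : w = v by case/and3P: up => _ _ /eqP; rewrite last_rcons.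
subst w; exists (last u p, v) => //; apply/edges_fromP; split => /=.
  by case/and3P: up; rewrite rcons_path => /andP[].
move=> q vq; have uq := simple_path_rev vq.
(* Any path [q] back to [u], once reversed, has the same edges as the path [p], so it contains the
   last edge of [p]. *)
have : (last u p, v) \in path_edges u (rev (belast v q)).
  rewrite (simple_path_edges uq) -(simple_path_edges up) path_edges_rcons.
  by rewrite !inE eqxx.
case/path_edges_nodes => /= + _.
case/and3P: vq => _ _ /eqP qu.
by rewrite -[X in X :: rev _]qu -rev_rcons -lastI mem_rev.
Qed.

(* [W] is the set of nodes reached before the edges of [s] are followed. *)
Fixpoint tree_order u (W : {set V}) (s : seq (V * V)) : bool :=
  if s is e :: s' then
    [&& e \in edges_from E u, e.1 \in W, e.2 \notin W & tree_order u (e.2 |: W) s']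
  else W == finset.setT.

(** Induction over the remaining edges [s2]: the nodes reached so far are [u] and the ends of the
    edges [s1] already followed. *)
Lemma tree_order_ordered_edges u :
  tree_order u [set u]%SET (ordered_edges_from E u).
Proof.
rewrite /ordered_edges_from; set le := fun e f : V * V => _.
set s := sort le _.
have sP e : (e \in s) = (e \in edges_from E u) by rewrite mem_sort mem_enum.
have Us : uniq s by rewrite sort_uniq enum_uniq.
have ss : sorted le s by apply: sort_sorted => e f; exact: leq_total.
have let_tr : transitive le by move=> e f g; exact: leq_trans.
suff: forall s1 s2, s = s1 ++ s2 ->
    tree_order u (u |: [set e.2 | e in s1]%SET) s2.
  by move=> /(_ [::] _ erefl); congr tree_order; apply/setP => v; rewrite !inE;
     case: imsetP => [[]|_] //; rewrite orbF.
move=> s1 s2; elim: s2 s1 => [|e s2 IH] s1 sE /=.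
  apply/eqP/setP => v; rewrite !inE; have [//|vu /=] := eqVneq v u.
  have [e eu <-] := edges_from_ex vu; apply/imsetP; exists e => //.
  by rewrite -(cats0 s1) -sE sP.
have eu : e \in edges_from E u by rewrite -sP sE mem_cat inE eqxx orbT.
rewrite eu /=; apply/and3P; split.
- rewrite !inE; have [//|au /=] := eqVneq e.1 u.
  have [f fu fe] := edges_from_ex au; apply/imsetP; exists f => //.
  have : f \in s by rewrite sP.
  rewrite sE mem_cat => /orP[//|fs2]; exfalso.
  (* If the edge [f] entering [e.1] came after [e], sortedness would give [le e f], yet the path to
     [e.2] has one edge more than the path to [e.1]. *)
  have lef : le e f.
    have : sorted le (e :: s2) by apply: (subseq_sorted let_tr _ ss); rewrite sE suffix_subseq.
    rewrite /= path_sortedE // => /andP[/allP ale _].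
    by move: fs2; rewrite inE => /orP[/eqP ->|/ale //]; rewrite /le.
  have [te ne] := tree_path_edges_from eu.
  by move: lef; rewrite /le te fe cardsU1 ne add1n ltnn.
- rewrite !inE negb_or edges_from_target //=; apply/imsetP => -[f fs1 fe].
  have fu : f \in edges_from E u by rewrite -sP sE mem_cat fs1.
  have ef := edges_from_inj eu fu fe.
  by move: Us; rewrite sE cat_uniq => /and3P[_ /hasPn/(_ e)]; rewrite inE eqxx ef fs1 => /(_ isT).
- have := IH (rcons s1 e); rewrite cat_rcons => /(_ sE); congr tree_order.
  apply/setP => v; rewrite !inE orbCA; congr orb.
  apply/imsetP/orP => [[f]|[/eqP ->|/imsetP[f fs ->]]].
  + by rewrite mem_rcons inE => /orP[/eqP -> ->|fs ->]; [left|right; apply/imsetP; exists f].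
  + by exists e => //; rewrite mem_rcons inE eqxx.
  + by exists f => //; rewrite mem_rcons inE fs orbT.
Qed.

(** Connectedness of the subgraph on [W]; it turns an edge leaving [W] into a separation. *)
Definition linked (W : {set V}) :=
  forall v w, v \in W -> w \in W ->
    connect [rel a b | [&& (a, b) \in E, a \in W & b \in W]] v w.

Lemma linked1 u : linked [set u]%SET.
Proof. by move=> v w; rewrite !inE => /eqP -> /eqP ->; exact: connect0. Qed.

Lemma linkedU1 (W : {set V}) e : e \in E -> e.1 \in W -> linked W ->
  linked (e.2 |: W).
Proof.
case: e => a b /= abE aW WL.
pose r := [rel x y | [&& (x, y) \in E, x \in b |: W & y \in b |: W]].
have sub v w : v \in W -> w \in W -> connect r v w.
  move=> vW wW; apply: connect_sub (WL _ _ vW wW) => x y /= /and3P[xy xW yW].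
  by apply: connect1; rewrite /r /= xy !inE xW yW !orbT.
have ab : connect r a b by apply: connect1; rewrite /r /= abE !inE aW eqxx orbT.
have ba : connect r b a by apply: connect1; rewrite /r /= symE // !inE aW eqxx orbT.
move=> v w; rewrite !inE -/r => /orP[/eqP ->|vW] /orP[/eqP ->|wW].
- exact: connect0.
- exact: connect_trans ba (sub _ _ aW wW).
- exact: connect_trans (sub _ _ vW aW) ab.
- exact: sub.
Qed.

(** A simple path inside [W] from [w] to [a], extended by [b], is a simple path from [w] to [b]; by
    uniqueness every such path uses the edge [(a, b)]. *)
Lemma linked_separates (W : {set V}) a b : (a, b) \in E -> a \in W -> b \notin W ->
  linked W -> separates E [set a]%SET (W :\ a)%SET [set b]%SET.
Proof.
move=> abE aW bW WL w c p; rewrite !inE => /andP[_ wW] /eqP -> wp.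
exists a; first by rewrite inE.
have /connectP[q0 qr aq] := WL _ _ wW aW.
have {q0 qr aq}[q [qr Uq aq]] : exists q, [/\
    path [rel a b | [&& (a, b) \in E, a \in W & b \in W]] w q, uniq (w :: q) & a = last w q].
  by move: aq; case/shortenP: qr => q qr Uq _ ->; exists q.
have qW : {subset w :: q <= W}.
  elim: q w {Uq aq wp} wW qr => [w wW _ x|x q IH w wW /=]; first by rewrite inE => /eqP ->.
  move=> /andP[/and3P[_ _ xW] qr] y; rewrite inE => /orP[/eqP -> //|].
  exact: IH.
have wqb : simple_path E w b (rcons q b).
  apply/and3P; split.
  - rewrite rcons_path -aq abE andbT; apply: sub_path qr.
    by move=> x y /= /and3P[].
  - by rewrite -rcons_cons rcons_uniq Uq andbT; apply: contra bW; exact: qW.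
  - by rewrite last_rcons.
have : (a, b) \in path_edges w p.
  by rewrite (simple_path_edges wp) -(simple_path_edges wqb) path_edges_rcons -aq !inE eqxx.
by case/path_edges_nodes.
Qed.

End tree_paths.

(** * Kernels and conditional distributions *)

Definition image_measure d1 d2 (T1 : measurableType d1) (T2 : measurableType d2)
    (R : realType) (m : {measure set T1 -> \bar R}) (f : T1 -> T2)
    (mf : measurable_fun setT f) : {measure set T2 -> \bar R}.
Proof. by unshelve refine (pushforward m f : {measure set T2 -> \bar R}). Defined.

Section integral_mixture.
Local Open Scope ereal_scope.
Context d1 d2 (T1 : measurableType d1) (T2 : measurableType d2) (R : realType).
Variables (m : {measure set T1 -> \bar R}) (D : set T1)
  (k : T1 -> {measure set T2 -> \bar R}) (n : {measure set T2 -> \bar R}).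
Hypotheses (mD : measurable D)
  (mk : forall B, measurable B -> measurable_fun setT (k ^~ B))
  (nE : forall B, measurable B -> n B = \int[m]_(x in D) k x B).

Import HBNNSimple.

Let mixture_nnsfun (h : {nnsfun T2 >-> R}) :
  \int[n]_y (h y)%:E = \int[m]_(x in D) \int[k x]_y (h y)%:E.
Proof.
rewrite integralT_nnsfun sintegralE.
under [RHS]eq_integral do rewrite integralT_nnsfun sintegralE.
have hk x r : r \in range h -> 0 <= r%:E * k x (h @^-1` [set r]).
  by rewrite inE => -[y _ <-]; rewrite mule_ge0 // lee_fin.
have mh r : measurable (h @^-1` [set r]) by [].
(* The value 0 off the range makes [g r] nonnegative for every real [r], as the exchange of sum and
   integral demands. *)
pose g r x := if r \in range h then r%:E * k x (h @^-1` [set r]) else 0.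
rewrite (eq_integral (fun x => \sum_(r \in range h) g r x)); last first.
  by move=> x _; apply: eq_fsbigr => r rh; rewrite /g rh.
rewrite ge0_integral_fsum //.
- apply: eq_fsbigr => r rh; rewrite /g rh nE // ge0_integralZl //.
  + exact: measurable_funTS (mk _).
  + by move: rh; rewrite inE => -[y _ <-]; rewrite lee_fin.
- move=> r; rewrite /g; case: (r \in range h); last exact: measurable_cst.
  by apply: measurable_funeM; exact: measurable_funTS (mk _).
- by move=> r x _; rewrite /g; case: ifP => // /hk.
Qed.

(** The identity for sets passes to simple functions by linearity and to [g] by monotone
    convergence. It serves for images, compositions of kernels and disintegrations alike. *)
Lemma integral_mixture (g : T2 -> \bar R) : measurable_fun setT g ->
  (forall y, 0 <= g y) ->
  \int[n]_y g y = \int[m]_(x in D) \int[k x]_y g y.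
Proof.
move=> mg g0; pose g_ := nnsfun_approx measurableT mg.
have g_mono y : {homo (fun i => (g_ i y)%:E) : i j / (i <= j)%N >-> i <= j}.
  by move=> i j ij; rewrite lee_fin; exact/lefP/nd_nnsfun_approx.
have mg_ i : measurable_fun setT (fun y => (g_ i y)%:E) by exact/measurable_EFinP.
have g_0 i y : 0 <= (g_ i y)%:E by rewrite lee_fin.
have lim_g (nu : {measure set T2 -> \bar R}) :
    \int[nu]_y g y = limn (fun i => \int[nu]_y (g_ i y)%:E).
  rewrite -monotone_convergence //.
  by apply: eq_integral => y _; apply/esym/cvg_lim => //; exact: cvg_nnsfun_approx.
rewrite lim_g; under [RHS]eq_integral do rewrite lim_g.
rewrite monotone_convergence //.
- by congr (limn _); apply/funext => i; rewrite mixture_nnsfun.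
- by move=> i; apply: measurable_funTS; exact: measurable_fun_integral_kernel.
- by move=> i x _; exact: integral_ge0.
- move=> x _ i j ij; apply: ge0_le_integral => //.
  by move=> y _; exact: g_mono.
Qed.

End integral_mixture.

Lemma integral_image_mrestr d1 d2 (T1 : measurableType d1) (T2 : measurableType d2)
    (R : realType) (m : {measure set T1 -> \bar R}) (D : set T1) (mD : measurable D)
    (f : T1 -> T2) (mf : measurable_fun setT f) (g : T2 -> \bar R) :
  measurable_fun setT g -> (forall y, 0 <= g y)%E ->
  (\int[image_measure (mrestr m mD) mf]_y g y = \int[m]_(x in D) g (f x))%E.
Proof.
move=> mg g0; rewrite (@integral_mixture _ _ T1 T2 R m D (fun x => \d_(f x)) _ mD) //.
- by apply: eq_integral => x _; rewrite integral_dirac // diracT mul1e.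
- by move=> B mB; exact: (measurable_kernel (kdirac mf)).
- move=> B mB; rewrite /= /pushforward /mrestr /=.
  rewrite (eq_integral (fun x => (\1_(f @^-1` B) x)%:E)); last first.
    by move=> x _; rewrite diracE indicE; congr (_%:R%:E); apply/idP/idP; rewrite !inE.
  rewrite integral_indic //.
  by rewrite -[X in measurable X]setTI; apply: (mf measurableT).
Qed.

Section conditional_distributions.
Local Open Scope ereal_scope.
Context d (T : measurableType d) (R : realType) (P : probability T R).

Lemma integral_cond_dist d1 d2 (T1 : measurableType d1) (T2 : measurableType d2)
    (Z : T -> T1) (Y : T -> T2) (k : R.-pker T1 ~> T2) A (g : T2 -> \bar R) :
  measurable_fun setT Z -> measurable_fun setT Y -> cond_dist P Z Y k ->
  measurable A -> measurable_fun setT g -> (forall y, 0 <= g y) ->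
  \int[P]_(w in Z @^-1` A) g (Y w) = \int[P]_(w in Z @^-1` A) \int[k (Z w)]_y g y.
Proof.
move=> mZ mY ZYk mA mg g0.
have mD : measurable (Z @^-1` A) by rewrite -[X in measurable X]setTI; exact: mZ.
rewrite -(integral_image_mrestr P mD mY) //.
apply: (integral_mixture mD) => //.
- move=> B mB; exact: measurableT_comp (measurable_kernel k B mB) mZ.
- by move=> B mB; rewrite /= /pushforward /mrestr /= -ZYk // setIC.
Qed.

End conditional_distributions.

Section kernel_pushforward.
Context d1 d2 d3 (T1 : measurableType d1) (T2 : measurableType d2)
  (T3 : measurableType d3) (R : realType).
Variables (k : R.-pker T1 ~> T2) (g : T1 * T2 -> T3) (mg : measurable_fun setT g).

Let mgx x : measurable_fun setT (fun y => g (x, y)).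
Proof. exact: measurableT_comp mg (pair1_measurable x). Qed.

Definition kpush x : {measure set T3 -> \bar R} := image_measure (k x) (mgx x).

Let measurable_kpush U : measurable U -> measurable_fun setT (kpush ^~ U).
Proof.
move=> mU; rewrite [X in measurable_fun _ X](_ : _ = fun x => k x (xsection (g @^-1` U) x)).
  apply: measurable_fun_xsection_finite_kernel; rewrite inE.
  by rewrite -[X in measurable X]setTI; exact: mg.
by apply/funext => x; rewrite xsectionE.
Qed.

HB.instance Definition _ := isKernel.Build _ _ _ _ _ kpush measurable_kpush.

Let kpush_prob x : kpush x setT = 1%E.
Proof. by rewrite /kpush /= /pushforward preimage_setT prob_kernel. Qed.

HB.instance Definition _ :=
  Kernel_isProbability.Build _ _ _ _ _ kpush kpush_prob.

End kernel_pushforward.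

Section kernel_precomposition.
Context d1 d2 d3 (T1 : measurableType d1) (T2 : measurableType d2)
  (T3 : measurableType d3) (R : realType).
Variables (f : T1 -> T2) (mf : measurable_fun setT f) (k : R.-pker T2 ~> T3).

(** The measurability proof is an argument of the term so that unification can recover it for the
    kernel instances. *)
Definition kpre of measurable_fun setT f := fun x => k (f x) : {measure set T3 -> \bar R}.

Let measurable_kpre U : measurable U -> measurable_fun setT (kpre mf ^~ U).
Proof. by move=> mU; exact: (measurableT_comp (measurable_kernel k U mU) mf). Qed.

HB.instance Definition _ :=
  isKernel.Build _ _ _ _ _ (kpre mf) measurable_kpre.

Let kpre_prob x : kpre mf x setT = 1%E.
Proof. exact: prob_kernel. Qed.

HB.instance Definition _ :=
  Kernel_isProbability.Build _ _ _ _ _ (kpre mf) kpre_prob.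

End kernel_precomposition.

Section joint_law.
Local Open Scope ereal_scope.
Context d d1 d2 (T : measurableType d) (R : realType) (P : probability T R)
  (T1 : measurableType d1) (T2 : measurableType d2).
Variables (Z : T -> T1) (Y : T -> T2) (k : R.-pker T1 ~> T2).
Hypotheses (mZ : measurable_fun setT Z) (mY : measurable_fun setT Y).

Let mZ2 : measurable_fun setT (fun p : T * T2 => (Z p.1, p.2)).
Proof.
apply/measurable_fun_pairP; split.
  exact: measurableT_comp mZ measurable_fst.
exact: measurable_snd.
Qed.

(** [P] is viewed as a kernel from [unit] and composed with the kernel sending [w] to the law of
    [(Z w, y)], where [y] is drawn from [k (Z w)]; this makes the result a measure by
    construction. *)
Definition joint_law : {measure set (T1 * T2) -> \bar R} :=
  Defs.pcomp (kprobability (measurable_cst (P : pprobability T R)) : R.-pker unit ~> T)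
    (kpush (kpre k mZ) mZ2) tt.

Lemma joint_lawE C : joint_law C = \int[P]_w k (Z w) (xsection C (Z w)).
Proof. by apply: eq_integral => w _; rewrite xsectionE. Qed.

Lemma joint_lawX A B : measurable A -> measurable B ->
  joint_law (A `*` B) = \int[P]_(w in Z @^-1` A) k (Z w) B.
Proof.
move=> mA mB; rewrite joint_lawE [RHS]integral_mkcond.
apply: eq_integral => w _; rewrite /restrict /=; case: ifPn.
  by rewrite inE /= => ZA; rewrite in_xsectionX // inE.
by rewrite notin_setE /= => ZA; rewrite notin_xsectionX ?measure0 // notin_setE.
Qed.

(** For fixed [B] both sides are finite measures in [A], so agreement on a pi-system containing the
    whole space is enough. *)
Lemma cond_dist_generator (G : set (set T1)) :
  measurable = <<s G >> -> setI_closed G -> G setT ->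
  (forall A B, G A -> measurable B ->
    P (Z @^-1` A `&` Y @^-1` B) = \int[P]_(w in Z @^-1` A) k (Z w) B) ->
  cond_dist P Z Y k.
Proof.
move=> mG GI GT GB A B mA mB.
have mYB : measurable (Y @^-1` B) by rewrite -[X in measurable X]setTI; exact: mY.
have mTB : measurable ([set: T1] `*` B) by exact: measurableX.
pose n1 := image_measure (mrestr P mYB) mZ.
pose n2 := image_measure (mrestr joint_law mTB) (@measurable_fst _ _ T1 T2).
have n2E C : measurable C -> n2 C = \int[P]_(w in Z @^-1` C) k (Z w) B.
  move=> mC; rewrite -joint_lawX //; congr (joint_law _).
  by apply/seteqP; split => -[x y] /=; tauto.
rewrite -n2E //; change (n1 A = n2 A).
apply: (measure_unique G (fun=> setT)) => //; first exact: bigcup_const.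
  move=> C GC; rewrite n2E; first exact: GB.
  by rewrite mG; exact: sub_sigma_algebra.
move=> _; rewrite /n1 /= /pushforward /mrestr preimage_setT setTI.
by rewrite (le_lt_trans (probability_le1 _ _)) ?ltry.
Qed.

Lemma joint_law_cond_dist C : cond_dist P Z Y k -> measurable C ->
  P ((fun w => (Z w, Y w)) @^-1` C) = joint_law C.
Proof.
move=> ZYk mC.
have mZY : measurable_fun setT (fun w => (Z w, Y w)) by exact: measurable_fun_pair.
change (image_measure P mZY C = joint_law C).
apply: (measure_unique [set A `*` B | A in measurable & B in measurable] (fun=> setT)) => //.
- exact: measurable_prod_measurableType.
- move=> _ _ [A1 mA1 [B1 mB1 <-]] [A2 mA2 [B2 mB2 <-]].
  by exists (A1 `&` A2); [exact: measurableI|exists (B1 `&` B2); [exact: measurableI|rewrite setXI]].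
- by move=> _; exists setT => //; exists setT => //; rewrite setXTT.
- exact: bigcup_const.
- by move=> _ [A mA [B mB <-]]; rewrite joint_lawX // -ZYk.
- move=> _; rewrite /= /pushforward preimage_setT.
  by rewrite (le_lt_trans (probability_le1 _ _)) ?ltry.
Qed.

End joint_law.

Section cond_dist_operations.
Local Open Scope ereal_scope.
Context d (T : measurableType d) (R : realType) (P : probability T R).

(** The joint law of [Z] and [Y], determined by rectangles, is evaluated on a set that need not be
    one. *)
Lemma cond_dist_push d1 d2 d3 (T1 : measurableType d1) (T2 : measurableType d2)
    (T3 : measurableType d3) (Z : T -> T1) (Y : T -> T2) (k : R.-pker T1 ~> T2)
    (g : T1 * T2 -> T3) (mg : measurable_fun setT g) :
  measurable_fun setT Z -> measurable_fun setT Y -> cond_dist P Z Y k ->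
  cond_dist P Z (fun w => g (Z w, Y w)) (kpush k mg).
Proof.
move=> mZ mY ZYk A B mA mB.
have mC : measurable ((A `*` setT) `&` g @^-1` B).
  by apply: measurableI; [exact: measurableX|rewrite -[X in measurable X]setTI; exact: mg].
have := joint_law_cond_dist mZ mY ZYk mC; rewrite joint_lawE.
rewrite (_ : _ @^-1` _ = Z @^-1` A `&` (fun w => g (Z w, Y w)) @^-1` B); last first.
  by apply/seteqP; split => w /=; tauto.
move=> ->; rewrite [RHS]integral_mkcond; apply: eq_integral => w _.
rewrite /restrict /=; case: ifPn.
  rewrite inE /= => ZA; rewrite /kpush /= /pushforward; congr (k _ _).
  by apply/seteqP; split => y; rewrite /xsection /= inE /=; tauto.
rewrite notin_setE /= => ZA; rewrite (_ : xsection _ _ = set0) ?measure0 //.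
by apply/seteqP; split => y //; rewrite /xsection /= inE /=; tauto.
Qed.

(** Since [Z0] is a function of [Z1], an event about [Z0] is one about [Z1], and the conditional law
    of [Z2] given [Z1] can be integrated over it. *)
Lemma cond_dist_comp d0 d1 d2 (T0 : measurableType d0) (T1 : measurableType d1)
    (T2 : measurableType d2) (Z0 : T -> T0) (Z1 : T -> T1) (Z2 : T -> T2)
    (f : T1 -> T0) (k1 : R.-pker T0 ~> T1) (k2 : R.-pker T1 ~> T2) :
  measurable_fun setT Z0 -> measurable_fun setT Z1 -> measurable_fun setT f ->
  (forall w, Z0 w = f (Z1 w)) ->
  cond_dist P Z0 Z1 k1 -> cond_dist P Z1 Z2 k2 -> cond_dist P Z0 Z2 (Defs.pcomp k1 k2).
Proof.
move=> mZ0 mZ1 mf Zf Z01 Z12 A B mA mB.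
have ZA : Z0 @^-1` A = Z1 @^-1` (f @^-1` A).
  by apply/seteqP; split => w /=; rewrite Zf.
rewrite ZA Z12 //; last by rewrite -[X in measurable X]setTI; exact: mf.
rewrite -ZA (integral_cond_dist (g := fun y => k2 y B) mZ0 mZ1 Z01) //.
exact: measurable_kernel.
Qed.

Lemma cond_dist_eq d1 d2 (T1 : measurableType d1) (T2 : measurableType d2)
    (Z : T -> T1) (Y : T -> T2) (k k' : R.-pker T1 ~> T2) :
  (forall x B, measurable B -> k x B = k' x B) ->
  cond_dist P Z Y k -> cond_dist P Z Y k'.
Proof.
by move=> kk' ZYk A B mA mB; rewrite ZYk //; apply: eq_integral => w _; exact: kk'.
Qed.

End cond_dist_operations.

Section cond_dist_kdirac.
Context d (T : measurableType d) (R : realType) (P : probability T R).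

Lemma cond_dist_kdirac d1 d2 (T1 : measurableType d1) (T2 : measurableType d2)
    (Y : T -> T1) (f : T1 -> T2) (mf : measurable_fun setT f) :
  measurable_fun setT Y -> cond_dist P Y (f \o Y) (kdirac mf).
Proof.
move=> mY A B mA mB.
rewrite (eq_integral (fun w => (\1_((f \o Y) @^-1` B) w)%:E)); last first.
  by move=> w _; rewrite /kdirac /= diracE indicE; congr (_%:R%:E); apply/idP/idP; rewrite !inE.
rewrite integral_indic.
- by rewrite setIC.
- by rewrite -[X in measurable X]setTI; exact: mY.
- rewrite -[X in measurable X]setTI; exact: (measurableT_comp mf mY).
Qed.

End cond_dist_kdirac.

Section cylinders.
Variables (V : finType) (R : realType).

Definition cylinder (A : V -> set R) : set (rvec V R) :=
  [set x | forall v, A v (x v)].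

Definition cylinders : set (set (rvec V R)) :=
  [set cylinder A | A in [set A | forall v, measurable (A v)]].

Lemma measurable_cylinder A : (forall v, measurable (A v)) -> measurable (cylinder A).
Proof.
move=> mA; rewrite (_ : cylinder A = \bigcap_(v in setT) ((fun x : rvec V R => x v) @^-1` A v)).
  apply: fin_bigcap_measurable => // v _.
  by rewrite -[X in measurable X]setTI; exact: measurable_coord.
by apply/seteqP; split => [x xA v _|x xA v]; exact: xA.
Qed.

Lemma measurable_cylinders : measurable = <<s cylinders >>.
Proof.
apply/seteqP; split; last first.
  apply: smallest_sub; first exact: sigma_algebra_measurable.
  by move=> _ [A mA <-]; exact: measurable_cylinder.
apply: smallest_sub; first exact: smallest_sigma_algebra.
move=> _ [v _ [B mB <-]]; apply: sub_sigma_algebra.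
exists (fun v' => if v' == v then B else setT); first by move=> v'; case: ifP.
apply/seteqP; split => x /=; last by move=> [_ xB] v'; case: eqP => // ->.
by move=> /(_ v); rewrite eqxx.
Qed.

Lemma cylinders_setI : setI_closed cylinders.
Proof.
move=> _ _ [A mA <-] [B mB <-]; exists (fun v => A v `&` B v).
  by move=> v; exact: measurableI.
by apply/seteqP; split => x /=; [move=> xAB; split=> v; have [] := xAB v|case=> xA xB v].
Qed.

Lemma cylindersT : cylinders setT.
Proof. by exists (fun=> setT) => //; apply/seteqP; split. Qed.

Lemma cond_dist_cylinders d d2 (T : measurableType d) (P : probability T R)
    (T2 : measurableType d2) (Z : T -> rvec V R) (Y : T -> T2)
    (k : R.-pker rvec V R ~> T2) :
  measurable_fun setT Z -> measurable_fun setT Y ->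
  (forall A B, (forall v, measurable (A v)) -> measurable B ->
    P (Z @^-1` cylinder A `&` Y @^-1` B) =
    (\int[P]_(w in Z @^-1` cylinder A) k (Z w) B)%E) ->
  cond_dist P Z Y k.
Proof.
move=> mZ mY ZYk; apply: (cond_dist_generator mZ mY measurable_cylinders).
- exact: cylinders_setI.
- exact: cylindersT.
- by move=> _ B [A mA <-] mB; exact: ZYk.
Qed.

End cylinders.

(** * Composition of kernels along the tree *)

Section composition_along_tree.
Context d (T : measurableType d) (R : realType) (P : probability T R).
Variables (V : finType) (E : {set V * V}) (u : V) (K : V * V -> R.-pker R ~> R).
Variable Y : V -> T -> R.
Hypothesis mY : forall v, measurable_fun setT (Y v).

Definition box (W : {set V}) (A : V -> set R) : set T :=
  [set w | forall v, v \in W -> A v (Y v w)].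

(* The vector of the values drawn so far; the other coordinates carry the
   initial value, as in the definition of cond_law. *)
Definition reached (W : {set V}) (w : T) : rvec V R :=
  fun v => if v \in W then Y v w else Y u w.

Lemma measurable_box W A : (forall v, measurable (A v)) -> measurable (box W A).
Proof.
move=> mA; rewrite (_ : box W A = \bigcap_(v in [set` W]) (Y v @^-1` A v)).
  apply: fin_bigcap_measurable => // v _.
  by rewrite -[X in measurable X]setTI; exact: mY.
by apply/seteqP; split => w wA v vW; exact: wA.
Qed.

Lemma measurable_reached W : measurable_fun setT (reached W).
Proof. by apply: measurable_rvec => v; rewrite /reached; case: (v \in W). Qed.

(** The Markov property in the form used by the composition, for an arbitrary family [Y], so that it
    covers both [X] and [theta]. *)
Definition one_step (W : {set V}) (e : V * V) := forall A B,
  (forall v, measurable (A v)) -> measurable B ->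
  P (box W A `&` Y e.2 @^-1` B) = (\int[P]_(w in box W A) K e (Y e.1 w) B)%E.

Lemma cond_dist_reached (W : {set V}) e : u \in W -> e.1 \in W -> e.2 \notin W ->
  one_step W e ->
  cond_dist P (reached W) (reached (e.2 |: W)) (edge_kernel (K e) e.1 e.2).
Proof.
move=> uW aW bW stepWe.
have WY : cond_dist P (reached W) (Y e.2) (coord_kernel (K e) e.1).
  apply: cond_dist_cylinders; [exact: measurable_reached|exact: mY|].
  move=> A B mA mB.
  (* The coordinates of [reached W] outside [W] carry [Y u], so their constraints are moved to
     [u]. *)
  pose A' v := if v == u then A u `&` \bigcap_(v in [set v | v \notin W]) A v else A v.
  have mA' v : measurable (A' v).
    rewrite /A'; case: ifP => // _; apply: measurableI => //.
    exact: fin_bigcap_measurable.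
  have -> : reached W @^-1` cylinder A = box W A'.
    apply/seteqP; split => [w wA v vW|w wA v]; rewrite /A' /reached.
      have := wA v; rewrite /reached vW; case: eqP => // -> Au; split=> // v' v'W.
      by have := wA v'; rewrite /reached (negPf v'W).
    case: ifPn => vW; first by have := wA _ vW; rewrite /A'; case: eqP => // -> [].
    by have := wA _ uW; rewrite /A' eqxx => -[_]; apply.
  rewrite stepWe //; apply: eq_integral => w _.
  change (K e (Y e.1 w) B = K e (reached W w e.1) B).
  by rewrite /reached aW.
have := cond_dist_push (measurable_upd e.2) (measurable_reached W) (@mY e.2) WY.
have -> : (fun w => upd (reached W w) e.2 (Y e.2 w)) = reached (e.2 |: W).
  apply/funext => w; apply/funext => v; rewrite /upd /reached !inE.
  by case: eqP => [->|].
exact: cond_dist_eq.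
Qed.

Variable inv : {set V} -> Prop.
Hypotheses (inv1 : inv [set u]%SET)
  (invU : forall W e, inv W -> e \in edges_from E u -> e.1 \in W ->
    e.2 \notin W -> inv (e.2 |: W))
  (step : forall W e, inv W -> e \in edges_from E u -> e.1 \in W ->
    e.2 \notin W -> one_step W e).

(** [inv] is a property of the reached sets under which one step is available: connectedness for
    [X], closedness under paths from [u] for [theta]. *)
Lemma cond_dist_edges_kernel s (W : {set V}) : inv W -> u \in W -> tree_order E u W s ->
  cond_dist P (reached W) (fun w => (Y ^~ w : rvec V R)) (edges_kernel K s).
Proof.
elim: s W => [|e s IH] W iW uW /=.
  move=> /eqP WT; rewrite WT.
  have -> : reached finset.setT = (fun w => (Y ^~ w : rvec V R)).
    by apply/funext => w; apply/funext => v; rewrite /reached inE.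
  have mYv : measurable_fun setT (fun w => (Y ^~ w : rvec V R)) by exact: measurable_rvec.
  exact: (cond_dist_kdirac P (@measurable_id _ (rvec V R) setT) mYv).
case/and4P => eu aW bW sW.
have IHs := IH _ (invU iW eu aW bW) (finset.setU1r _ uW) sW.
have WW' := cond_dist_reached uW aW bW (step iW eu aW bW).
(* [reached W] is recovered from [reached (e.2 |: W)] by putting the value at [u] back at [e.2]. *)
apply: (cond_dist_comp (f := fun x : rvec V R => upd x e.2 (x u)) _ _ _ _ WW' IHs).
- exact: measurable_reached.
- exact: measurable_reached.
- apply: measurable_rvec => v; rewrite /upd; case: (v == e.2); exact: measurable_coord.
- move=> w; apply/funext => v; rewrite /upd /reached !inE uW orbT.
  by case: eqP => [->|]; rewrite ?(negPf bW).
Qed.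

Lemma cond_dist_cond_law : undirected_tree E ->
  cond_dist P (Y u) (fun w => (Y ^~ w : rvec V R)) (cond_law K E u).
Proof.
move=> treeE.
have := cond_dist_edges_kernel inv1 (finset.set11 u) (tree_order_ordered_edges treeE u).
apply: (cond_dist_comp (f := fun x : rvec V R => x u)).
- exact: mY.
- exact: measurable_reached.
- exact: measurable_coord.
- by move=> w; rewrite /reached; case: ifP.
have -> : reached [set u]%SET = (fun t => (fun=> t) : rvec V R) \o Y u.
  by apply/funext => w; apply/funext => v; rewrite /reached inE; case: eqP => [->|].
exact: cond_dist_kdirac.
Qed.

End composition_along_tree.

(** * Weak convergence *)

Section rvec_topology.
Variables (V : finType) (R : realType).

Lemma coord_continuous (v : V) : continuous (fun x : rvec V R => x v).
Proof. exact: (@proj_continuous V (fun=> R : topologicalType) v). Qed.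

Lemma rvec_cvg (I : Type) (F : set_system I) (f : I -> rvec V R) (z : rvec V R) :
  Filter F -> (forall v, f i v @[i --> F] --> z v) -> f @ F --> z.
Proof.
move=> FF fz; apply/(@cvg_sup (rvec V R) V
  (fun v => Topological.class (initial_topology (fun x : V -> R => x v)))) => v.
move=> A; rewrite nbhsE => -[B [[C Copen <-] zC] BA].
have : nbhs (z v) C by exact: open_nbhs_nbhs.
move=> zCn; change (F (f @^-1` A)); have : F [set i | C (f i v)] := fz v C zCn.
by apply: filterS => i; exact: BA.
Qed.

End rvec_topology.

Section bounded_integrals.
Context d (T : measurableType d) (R : realType) (m : probability T R).
Implicit Types f g h : T -> R.

Lemma integrable_bounded f (C : R) : measurable_fun setT f ->
  (forall x, `|f x| <= C) -> m.-integrable setT (EFin \o f).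
Proof.
move=> mf fC; apply: measurable_bounded_integrable => //.
  by rewrite (le_lt_trans (probability_le1 _ _)) ?ltry.
exists C; split; first exact: num_real.
by move=> x Cx y _ /=; rewrite (le_trans (fC y)) // ltW.
Qed.

Lemma integral_bounded f (C : R) : measurable_fun setT f ->
  (forall x, `|f x| <= C) ->
  (\int[m]_x (f x)%:E)%E = (\int[m]_x f x)%:E.
Proof.
by move=> mf fC; rewrite /Rintegral fineK // integrable_fin_num //; exact: integrable_bounded fC.
Qed.

(** With [h] a cutoff or an indicator, the affine bound separates the points where [f] and [g] are
    close from those where only their size is controlled. *)
Lemma Rintegral_dist f g h (a b C : R) : measurable_fun setT f ->
  measurable_fun setT g -> measurable_fun setT h ->
  (forall x, `|f x| <= C) -> (forall x, `|g x| <= C) -> (forall x, `|h x| <= C) ->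
  (forall x, `|f x - g x| <= a + b * h x) ->
  `|\int[m]_x f x - \int[m]_x g x| <= a + b * \int[m]_x h x.
Proof.
move=> mf mg mh fC gC hC fgh.
have intf := integrable_bounded mf fC; have intg := integrable_bounded mg gC.
have inth := integrable_bounded mh hC.
have inta : m.-integrable setT (EFin \o (fun=> a)).
  exact: (integrable_bounded (C := `|a|)).
have intb : m.-integrable setT (EFin \o (fun x => b * h x)) by exact: (integrableZl measurableT b inth).
rewrite -RintegralB //; apply: le_trans (le_normr_Rintegral _ _) _ => //.
  exact: (integrableB measurableT intf intg).
rewrite -RintegralZl // (_ : a = \int[m]_x a); last first.
  transitivity (a * fine (m setT)); first by rewrite probability_setT mulr1.
  by rewrite Rintegral_cst.
rewrite -RintegralD //; apply: le_Rintegral => //.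
- have := integrable_norm (integrableB measurableT intf intg); exact.
- exact: (integrableD measurableT inta intb).
Qed.

End bounded_integrals.

(** * An extended continuous mapping theorem *)

Section extended_mapping.
Variable R : realType.

(* A cutoff equal to 0 off the compact set of the y with |y| <= n and
   1 <= n * dlt y, and tending to 1 where dlt is positive. *)
Definition cutoff (dlt : R -> R) (n : nat) (y : R) : R :=
  Num.max 0 (Num.min 1 (Num.min (n%:R - `|y|) (n%:R * dlt y - 1))).

Lemma cutoff_itv dlt n y : 0 <= cutoff dlt n y <= 1.
Proof. by rewrite /cutoff le_max lexx ge_max ler01 ge_min lexx. Qed.

Lemma cvgr_max (f g : R -> R) (F : set_system R) (a b : R) : Filter F ->
  f @ F --> a -> g @ F --> b -> Num.max (f x) (g x) @[x --> F] --> Num.max a b.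
Proof.
move=> FF fa gb; rewrite maxr_absE; under eq_fun do rewrite maxr_absE.
by apply: cvgM; [apply: cvgD; [exact: cvgD|apply: cvg_norm; exact: cvgB]|exact: cvg_cst].
Qed.

Lemma cvgr_min (f g : R -> R) (F : set_system R) (a b : R) : Filter F ->
  f @ F --> a -> g @ F --> b -> Num.min (f x) (g x) @[x --> F] --> Num.min a b.
Proof.
move=> FF fa gb; rewrite minr_absE; under eq_fun do rewrite minr_absE.
by apply: cvgM; [apply: cvgB; [exact: cvgD|apply: cvg_norm; exact: cvgB]|exact: cvg_cst].
Qed.

Lemma cutoff_continuous dlt n : continuous dlt -> continuous (cutoff dlt n).
Proof.
move=> cd y; apply: cvgr_max; first exact: cvg_cst.
apply: cvgr_min; first exact: cvg_cst.
apply: cvgr_min.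
  by apply: cvgB; [exact: cvg_cst|exact: norm_continuous].
apply: cvgB; last exact: cvg_cst.
by apply: cvgM; [exact: cvg_cst|exact: cd].
Qed.

Lemma cutoff_eq0 dlt n y : ~ (`|y| <= n%:R /\ 1 <= n%:R * dlt y) ->
  cutoff dlt n y = 0.
Proof.
move=> yK; apply/max_idPl; rewrite ge_min ge_min; apply/orP; right; apply/orP.
have [yn|yn] := leP `|y| n%:R; last by left; rewrite subr_le0 ltW.
by right; rewrite subr_le0 leNgt; apply/negP => ?; apply: yK; split=> //; exact: ltW.
Qed.

Lemma cutoff_cvg dlt y : 0 < dlt y -> cutoff dlt n y @[n --> \oo] --> (1 : R).
Proof.
move=> dy; apply: cvg_near_cst; near=> n.
rewrite /cutoff min_l; first by rewrite max_r.
rewrite le_min lerBrDr lerBrDr; apply/andP; split.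
  by near: n; exact: nbhs_infty_ger.
rewrite -ler_pdivrMr //.
by near: n; exact: nbhs_infty_ger.
Unshelve. all: by end_near. Qed.

Section mapping.
Variables (I : Type) (F : set_system I) (kap_ : I -> probability R R)
  (kap : probability R R) (H_ : I -> R -> R) (H dlt : R -> R) (C : R).
Hypotheses (FF : ProperFilter F) (cdlt : continuous dlt) (dlt0 : forall y, 0 <= dlt y)
  (kap_dlt : kap [set y | dlt y = 0] = 0%E)
  (weak_kap : forall phi : R -> R, continuous phi -> bounded_fun phi ->
    (\int[kap_ i]_x (phi x)%:E)%E @[i --> F] --> (\int[kap]_x (phi x)%:E)%E)
  (mH_ : forall i, measurable_fun setT (H_ i)) (mH : measurable_fun setT H)
  (H_C : forall i y, `|H_ i y| <= C) (HC : forall y, `|H y| <= C)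
  (H_cvg : forall y, 0 < dlt y ->
    H_ p.1 p.2 @[p --> filter_prod F (nbhs y)] --> H y).

Let H_near y (e : R) : 0 < dlt y -> 0 < e -> exists2 A, F A & exists2 B, nbhs y B &
  forall i z, A i -> B z -> `|H y - H_ i z| < e.
Proof.
move=> dy e0; have /cvgrPdist_lt/(_ _ e0) [[A B] [/= FA yB] AB] := H_cvg dy.
by exists A => //; exists B => // i z Ai Bz; exact: (AB (i, z)).
Qed.

(** Continuous convergence forces a continuous limit: [H y] and [H z] are both compared with
    [H_ i z], for one [i] that serves the neighborhoods of [y] and of [z]; it exists because [F] is
    proper. *)
Let H_continuous y : 0 < dlt y -> {for y, continuous H}.
Proof.
move=> dy; apply/cvgrPdist_le => e e0.
have e20 : 0 < e / 2 by rewrite divr_gt0.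
have [A FA [B yB AB]] := H_near dy e20.
have ndy : dlt z @[z --> y] --> dlt y by exact: cdlt.
have dB : \forall z \near y, 0 < dlt z by apply: (cvgr_gt _ ndy).
near=> z.
have dz : 0 < dlt z by near: z.
have [A' FA' [B' zB' AB']] := H_near dz e20.
have [i [Ai A'i]] := filter_ex (filterI FA FA').
have Bz : B z by near: z.
rewrite (le_trans (ler_distD (H_ i z) _ _)) // (splitr e) lerD //.
  by apply: ltW; exact: AB.
rewrite distrC; apply: ltW; apply: AB' => //; exact: nbhs_singleton.
Unshelve. all: by end_near. Qed.

(** Convergence jointly in [i] and the point is locally uniform, and the points in question form a
    compact set on which [dlt] is positive. *)
Let unif n (e : R) : 0 < e ->
  \forall i \near F, forall y, `|y| <= n%:R -> 1 <= n%:R * dlt y -> `|H_ i y - H y| <= e.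
Proof.
move=> e0; pose Kn : set R := `[- n%:R, n%:R] `&` (fun y => n%:R * dlt y) @^-1` [set x | 1 <= x].
have cK : compact Kn.
  rewrite /Kn; apply: compact_closedI; first exact: segment_compact.
  apply: closed_comp; last exact: closed_ge.
  by move=> y _; apply: cvgM; [exact: cvg_cst|exact: cdlt].
have e20 : 0 < e / 2 by rewrite divr_gt0.
suff : \forall i \near F, Kn `<=` (fun y => `|H_ i y - H y| <= e).
  apply: filterS => i iK y yn ny; apply: iK; split => //=.
  by rewrite in_itv /= -ler_norml.
move/compact_near_coveringP : cK; apply => y [_ /= yK].
have dy : 0 < dlt y.
  rewrite lt_neqAle dlt0 andbT; apply/eqP => d0.
  by move: yK; rewrite -d0 mulr0 ler10.
have [A FA [B yB AB]] := H_near dy e20.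
have yB' := H_continuous dy; move/cvgrPdist_lt : yB' => /(_ _ e20) yB'.
exists (B `&` [set z | `|H y - H z| < e / 2], A) => /=.
  by split=> //; exact: filterI.
move=> [z i] [/= [Bz Hz] Ai].
rewrite (le_trans (ler_distD (H y) _ _)) // (splitr e) lerD //; last exact: ltW.
by rewrite distrC; apply: ltW; exact: AB.
Qed.

(** The cutoffs tend to 1 where [dlt] is positive, that is [kap]-almost surely; dominated
    convergence applies. *)
Let cutoff_mass (e : R) : 0 < e ->
  exists n, 1 - e <= \int[kap]_y cutoff dlt n y.
Proof.
move=> e0; pose D := [set y | 0 < dlt y].
have mD : measurable D.
  by apply: open_measurable; apply: (@open_comp _ _ dlt [set x | 0 < x]) => //; exact: open_gt.
have mc n : measurable_fun setT (cutoff dlt n).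
  by apply: continuous_measurable_fun; exact: cutoff_continuous.
have c1 n y : `|cutoff dlt n y| <= 1.
  by have /andP[c0 c1] := cutoff_itv dlt n y; rewrite ger0_norm.
have : (\int[kap]_(y in D) (cutoff dlt n y)%:E)%E @[n --> \oo] -->
       (\int[kap]_(y in D) (cst 1 y)%:E)%E.
  apply: (@dominated_cvg _ _ _ _ _ mD _ _ (fun=> 1%E)) => //.
  - by move=> n; apply/measurable_EFinP; exact: measurable_funTS.
  - by move=> y Dy; apply: cvg_EFin; [exact: nearW|exact: cutoff_cvg].
  - apply: (integrableS measurableT) => //.
    by apply: (integrable_bounded kap (f := fun=> 1) (C := 1)) => // x; rewrite normr1.
  - by move=> n y _; rewrite /= lee_fin.
have -> : (\int[kap]_(y in D) (cst 1 y)%:E)%E = 1%:E.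
  rewrite (eq_integral (cst 1%E)) // integral_cst // mul1e.
  rewrite -[RHS](@probability_setT _ _ _ kap) -[in RHS](setUv D) measureU //.
  - rewrite [X in (_ + X)%E](_ : _ = 0%E) ?adde0 // -kap_dlt; congr (kap _).
    apply/seteqP; split => y; rewrite /D /setC /=; last by move=> ->; rewrite ltxx.
    by move/negP; rewrite -leNgt => ?; apply/eqP; rewrite eq_le dlt0 andbT.
  - exact: measurableC.
  - exact: setICr.
move/fine_cvgP => [_ /cvgrPdist_lt/(_ _ e0)[n _ /(_ n (leqnn n))]] /=.
rewrite ltr_distl => /andP[_ cn].
exists n; rewrite lerBlDr (le_trans (ltW cn)) // lerD2r.
have ci : kap.-integrable setT (EFin \o cutoff dlt n).
  exact: (integrable_bounded kap (C := 1)).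
have ciD : kap.-integrable D (EFin \o cutoff dlt n).
  exact: (integrableS measurableT mD (@subsetT _ D) ci).
rewrite /Rintegral fine_le //.
- by rewrite integrable_fin_num.
- by rewrite integrable_fin_num.
- apply: ge0_subset_integral => //; first exact/measurable_EFinP.
  by move=> y _; rewrite lee_fin; have /andP[] := cutoff_itv dlt n y.
Qed.

Let weak_near phi (e : R) : continuous phi -> bounded_fun phi -> 0 < e ->
  \forall i \near F, `|\int[kap]_y phi y - \int[kap_ i]_y phi y| <= e.
Proof.
move=> cphi [M [_ bphi]] e0.
have phiM y : `|phi y| <= M + 1 by apply: bphi => //; rewrite ltrDl.
have mphi : measurable_fun setT phi by exact: continuous_measurable_fun.
have := weak_kap cphi; rewrite (integral_bounded kap mphi phiM) => wphi.
have /fine_cvgP[_] := wphi (ex_intro _ M (conj (num_real M) bphi)).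
by move=> /cvgrPdist_le/(_ _ e0).
Qed.

(** The exceptional set is where [dlt] vanishes. Both integrals are compared with those of [psi],
    which is [H] times a cutoff [phi] and is continuous and bounded. The mass that [kap_ i] puts
    where [phi] is below 1 is controlled by weak convergence applied to [phi] itself. *)
Lemma extended_mapping :
  (\int[kap_ i]_y (H_ i y)%:E)%E @[i --> F] --> (\int[kap]_y (H y)%:E)%E.
Proof.
rewrite (integral_bounded kap mH HC); apply/fine_cvgP; split.
  by apply: nearW => i; rewrite (integral_bounded (kap_ i) (mH_ i) (H_C i)).
apply/cvgrPdist_le => e e0.
have C0 : 0 <= C by exact: le_trans (HC 0).
(* The errors, in units of [eps]: [C] for the cutoff under [kap], [2 * C] for the cutoff under
   [kap_ i], 1 for weak convergence of [psi] and 1 for uniform convergence. *)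
have D0 : 0 < 3 * C + 2 by rewrite ltr_wpDl ?mulr_ge0.
pose eps := e / (3 * C + 2); have eps0 : 0 < eps by rewrite divr_gt0.
have [n kn] := cutoff_mass eps0.
set phi := cutoff dlt n in kn.
have phi01 y : 0 <= phi y <= 1 by exact: cutoff_itv.
have cphi : continuous phi by exact: cutoff_continuous.
have phi1 y : `|phi y| <= 1 by have /andP[p0 p1] := phi01 y; rewrite ger0_norm.
have mphi : measurable_fun setT phi by exact: continuous_measurable_fun.
pose psi y := H y * phi y.
(* H need not be continuous where dlt vanishes, but psi is 0 near such points. *)
have cpsi : continuous psi.
  move=> y; have := dlt0 y; rewrite le_eqVlt => /orP[/eqP dy|dy]; last first.
    by apply: cvgM; [exact: H_continuous|exact: cphi].
  have ndy : n%:R * dlt z @[z --> y] --> n%:R * dlt y.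
    by apply: cvgM; [exact: cvg_cst|exact: cdlt].
  have : \forall z \near y, n%:R * dlt z < 1.
    by apply: (cvgr_lt _ ndy); rewrite -dy mulr0.
  move=> nearz; have psi0 z : n%:R * dlt z < 1 -> psi z = 0.
    by move=> nz; rewrite /psi /phi cutoff_eq0 ?mulr0 // => -[_]; rewrite leNgt nz.
  rewrite /continuous_at (psi0 y); last by rewrite -dy mulr0.
  by apply: cvg_near_cst; apply: filterS nearz.
have psiC y : `|psi y| <= C.
  by rewrite normrM -[leRHS]mulr1 ler_pM.
have mpsi : measurable_fun setT psi by exact: continuous_measurable_fun.
have bd f : (exists M, forall y, `|f y| <= M) -> bounded_fun (f : R -> R).
  move=> [M fM]; exists M; split; first exact: num_real.
  by move=> x Mx y _; rewrite /= (le_trans (fM y)) // ltW.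
pose B := Num.max C 1.
have CB : C <= B by rewrite /B le_max lexx.
have oneB : 1 <= B by rewrite /B le_max lexx orbT.
near=> i.
have wphi : `|\int[kap]_y phi y - \int[kap_ i]_y phi y| <= eps.
  by near: i; apply: weak_near => //; apply: bd; exists 1.
have wpsi : `|\int[kap]_y psi y - \int[kap_ i]_y psi y| <= eps.
  by near: i; apply: weak_near => //; apply: bd; exists C.
have uH : forall y, `|y| <= n%:R -> 1 <= n%:R * dlt y -> `|H_ i y - H y| <= eps.
  by near: i; exact: unif.
have dk : `|\int[kap]_y H y - \int[kap]_y psi y| <= C + - C * \int[kap]_y phi y.
  apply: (Rintegral_dist kap (C := B)) => // y.
  - exact: le_trans (HC y) CB.
  - exact: le_trans (psiC y) CB.
  - exact: le_trans (phi1 y) oneB.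
  - have /andP[p0 p1] := phi01 y; rewrite /psi -{1}[H y]mulr1 -mulrBr normrM.
    have -> : C + - C * phi y = C * (1 - phi y) by ring.
    rewrite ler_pM //.
    by rewrite ger0_norm // subr_ge0.
have di : `|\int[kap_ i]_y H_ i y - \int[kap_ i]_y psi y| <=
    (C + eps) + - C * \int[kap_ i]_y phi y.
  apply: (Rintegral_dist (kap_ i) (C := B)) => // y.
  - exact: le_trans (H_C i y) CB.
  - exact: le_trans (psiC y) CB.
  - exact: le_trans (phi1 y) oneB.
  - have /andP[p0 p1] := phi01 y.
    have -> : H_ i y - psi y = (H_ i y - H y) * phi y + H_ i y * (1 - phi y).
      by rewrite /psi; ring.
    have -> : C + eps + - C * phi y = eps + C * (1 - phi y) by ring.
    rewrite (le_trans (ler_normD _ _)) // lerD //.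
      have [[yn dn]|yK] := pselect (`|y| <= n%:R /\ 1 <= n%:R * dlt y).
        by rewrite normrM -[leRHS]mulr1 ler_pM // uH.
      by rewrite /phi cutoff_eq0 // mulr0 normr0 ltW.
    by rewrite normrM ler_pM // ger0_norm // subr_ge0.
have e_eps : e = (3 * C + 2) * eps by rewrite /eps mulrC divfK // gt_eqF.
move: wphi wpsi dk di; rewrite !ler_distl => /andP[w1 w2] /andP[w3 w4] /andP[w5 w6] /andP[w7 w8].
have Ckn : C * (1 - eps) <= C * \int[kap]_y phi y by exact: ler_wpM2l.
have Cki : C * (1 - 2 * eps) <= C * \int[kap_ i]_y phi y.
  by apply: ler_wpM2l => //; lra.
rewrite /= -/(Rintegral _ _ _) e_eps.
move: (eps0) (C0) w1 w2 w3 w4 w5 w6 w7 w8 Ckn Cki; clear => *.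
by apply/andP; split; lra.
Unshelve. all: by end_near. Qed.

End mapping.
End extended_mapping.

Section rvec_measurability.
Variables (V : finType) (R : realType).

(* f is the limit of its values at the points of the grids (1/n) Z^V, which are
   countable. *)
Lemma continuous_measurable_rvec (f : rvec V R -> R) :
  continuous f -> measurable_fun setT f.
Proof.
move=> cf; pose r n (z : rvec V R) : rvec V R :=
  fun v => (Num.floor (n.+1%:R * z v))%:~R / n.+1%:R.
apply: (@measurable_fun_cvg _ _ _ _ (fun n z => f (r n z))) => [n|z _].
  move=> _ B mB; rewrite setTI.
  rewrite (_ : _ @^-1` _ = \bigcup_(q in [set q : {ffun V -> int} |
      B (f (fun v => (q v)%:~R / n.+1%:R : R))])
      cylinder (fun v => [set x : R | (q v)%:~R <= n.+1%:R * x < (q v + 1)%:~R])).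
    rewrite bigcup_mkcond; apply: countable_bigcupT_measurable; first exact: countableP.
    move=> q; case: ifP => // _; apply: measurable_cylinder => v.
    rewrite (_ : [set x | _] = (fun x => n.+1%:R * x) @^-1` `[(q v)%:~R, (q v + 1)%:~R[).
      have mm : measurable_fun setT (fun x : R => n.+1%:R * x) by exact: measurable_funM.
      by rewrite -[X in measurable X]setTI; apply: mm => //; exact: measurable_itv.
    by apply/seteqP; split => x /=; rewrite in_itv.
  apply/seteqP; split => z /=.
    move=> Bz; exists [ffun v => Num.floor (n.+1%:R * z v)].
      rewrite /= (_ : (fun v => _) = r n z) //.
      by apply/funext => v; rewrite /r ffunE.
    by move=> v /=; rewrite ffunE floor_itv.
  case=> q Bq zq; rewrite (_ : r n z = (fun v => (q v)%:~R / n.+1%:R)) //.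
  by apply/funext => v; rewrite /r (floor_def (zq v)).
have rz : (fun n => r n z) @ \oo --> z.
  apply: rvec_cvg => v; apply/cvgrPdist_le => e e0; near=> n.
  have n0 : (0 : R) < n.+1%:R by [].
  have /andP[f1 f2] := floor_itv (n.+1%:R * z v).
  rewrite /r -(ler_pM2l n0) -{1}(gtr0_norm n0) -normrM mulrBr mulrCA divff ?gt_eqF // mulr1.
  rewrite ger0_norm ?subr_ge0 // (@le_trans _ _ 1) //.
    by rewrite lerBlDl; move: f2; rewrite intrD => /ltW.
  rewrite -ler_pdivrMr // mul1r.
  have : e^-1 <= n%:R by near: n; exact: nbhs_infty_ger.
  by move/le_trans; apply; rewrite ler_nat.
exact: (cvg_comp _ _ rz (cf z)).
Unshelve. all: by end_near. Qed.

End rvec_measurability.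

(** * The Markov property *)

Section probability_kernel_laws.
Local Open Scope ereal_scope.
Context d1 d2 (T1 : measurableType d1) (T2 : measurableType d2) (R : realType).
Variable k : R.-pker T1 ~> T2.

(** The type of a kernel presents [k x] as a measure only; this copy carries the probability
    structure. *)
Definition klaw (x : T1) : set T2 -> \bar R := k x.

HB.instance Definition _ x := Measure.copy (klaw x) (k x).

Let klaw_setT x : klaw x setT = 1.
Proof. exact: prob_kernel. Qed.

HB.instance Definition _ x :=
  Measure_isProbability.Build _ _ _ (klaw x) (klaw_setT x).

Lemma pker_le1 x B : measurable B -> k x B <= 1.
Proof. exact: (@probability_le1 _ _ _ (klaw x : probability T2 R)). Qed.

Lemma pker_fin_num x B : measurable B -> k x B \is a fin_num.
Proof.
by move=> mB; rewrite ge0_fin_numE // (le_lt_trans (pker_le1 x mB)) ?ltry.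
Qed.

End probability_kernel_laws.

Section conditional_probability.
Local Open Scope ereal_scope.
Context d (T : measurableType d) (R : realType) (P : probability T R).

Lemma sigma_of_measurable (I : Type) (X : I -> T -> R) (W : set I) :
  (forall v, measurable_fun setT (X v)) -> sigma_of X W `<=` measurable.
Proof.
move=> mX; apply: smallest_sub; first exact: sigma_algebra_measurable.
by move=> _ [v _ [B mB <-]]; exact: mX.
Qed.

Lemma sigma_of1 (I : finType) (X : I -> T -> R) (a : I) D :
  sigma_of X [set` [set a]%SET] D -> exists2 C, measurable C & D = X a @^-1` C.
Proof.
move: D; apply: smallest_sub; last first.
  move=> _ [v /= + [B mB <-]]; rewrite inE => /eqP ->.
  by exists B => //; rewrite setTI.
split.
- by exists set0 => //; rewrite preimage_set0.
- move=> A [C mC ->]; exists (~` C); first exact: measurableC.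
  by rewrite setTD preimage_setC.
- move=> F mF; have /choice[C CP] : forall n, exists C, measurable C /\ F n = X a @^-1` C.
    by move=> n; have [C] := mF n; exists C.
  exists (\bigcup_n C n); first by apply: bigcup_measurable => n _; have [] := CP n.
  by rewrite preimage_bigcup; apply: eq_bigcupr => n _; have [] := CP n.
Qed.

Variables (G : set_system T) (F : set T).
Hypotheses (Gm : <<s G>> `<=` measurable).

(** On the space whose measurable sets are those of [<<s G>>], with the image of [P] under the
    identity, the two versions have equal integrals over all measurable sets. *)
Lemma cond_prob_unique p q : cond_prob P <<s G>> F p -> cond_prob P <<s G>> F q ->
  {ae P, forall w, p w = q w}.
Proof.
move=> [mp ip pF] [mq iq qF]; pose TG := g_sigma_algebraType G.
have mid : measurable_fun setT (id : T -> TG).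
  by move=> _ A mA; rewrite setTI; exact: Gm.
have mTG f : (forall B, measurable B -> <<s G>> (f @^-1` B)) ->
    measurable_fun setT (EFin \o f : TG -> \bar R).
  by move=> mf; apply/measurable_EFinP => _ B mB; rewrite setTI; exact: mf.
pose PG := image_measure P mid.
have : ae_eq PG setT (EFin \o p) (EFin \o q).
  apply: integral_ae_eq => //.
  - exact: (integrable_pushforward mid (mTG _ mp)).
  - exact: mTG.
  - move=> A _ mA; have mA' : measurable (A : set T) by exact: Gm.
    rewrite (integral_pushforward mid (mTG _ mp)) //; last exact: integrableS ip.
    rewrite (integral_pushforward mid (mTG _ mq)) //; last exact: integrableS iq.
    by rewrite pF // qF.
case=> A [mA A0 subA]; exists A; split => //; first exact: Gm.
move=> w pq; apply: subA => /(_ Logic.I) /= [].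
exact: pq.
Qed.

(** The set where [p] is negative belongs to the conditioning sigma-algebra, and the integral of [p]
    over it is a probability. *)
Lemma cond_prob_ge0 p : cond_prob P <<s G>> F p -> measurable F ->
  {ae P, forall w, (0 <= p w)%R}.
Proof.
move=> [mp ip pF] mF; pose D := [set w | (p w < 0)%R].
have GD : <<s G>> D.
  have -> : D = p @^-1` `]-oo, 0%R : R[ by apply/seteqP; split => w; rewrite /D /= in_itv.
  exact: mp.
have mD : measurable D by exact: Gm.
have ipD : P.-integrable D (EFin \o p) by exact: integrableS ip.
have mpD : measurable_fun D (EFin \o p) by exact: measurable_int ipD.
have : ae_eq P D (EFin \o p) (cst 0).
  apply/(ae_eq_integral_abs P mD mpD).
  apply/eqP; rewrite eq_le integral_ge0 // andbT.
  rewrite (eq_integral (fun w => - (p w)%:E)); last first.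
    by move=> w; rewrite inE => /ltW pw; rewrite /= ler0_norm.
  by rewrite integralN ?oppe_le0 ?pF ?measure_ge0 //; exact: integrable_add_def.
apply: filterS => w Dw; rewrite leNgt; apply/negP => pw.
by have := Dw pw; case=> pw0; rewrite pw0 ltxx in pw.
Qed.

End conditional_probability.

Section markov_step.
Local Open Scope ereal_scope.
Context d (T : measurableType d) (R : realType) (P : probability T R).

Lemma cond_prob_kernel (I : finType) (X : I -> T -> R) (a b : I)
    (k : R.-pker R ~> R) B :
  (forall v, measurable_fun setT (X v)) -> cond_dist P (X a) (X b) k ->
  measurable B ->
  cond_prob P (sigma_of X [set` [set a]%SET]) (X b @^-1` B)
    (fun w => fine (k (X a w) B)).
Proof.
move=> mX abk mB; have mk : measurable_fun setT (fun y => fine (k y B)).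
  by apply: measurableT_comp => //; exact: measurable_kernel.
have kfin y : k y B \is a fin_num by exact: pker_fin_num.
split.
- move=> C mC; apply: sub_sigma_algebra; exists a; first by rewrite /= inE.
  exists ((fun y => fine (k y B)) @^-1` C); last by rewrite setTI.
  by rewrite -[X in measurable X]setTI; exact: mk.
- apply: (integrable_bounded P (C := 1)); first exact: measurableT_comp mk (mX a).
  by move=> w; rewrite ger0_norm ?fine_ge0 // -lee_fin fineK // pker_le1.
- move=> D /sigma_of1[C mC ->]; rewrite setIC abk //.
  by apply: eq_integral => w _; rewrite fineK.
Qed.

(** [a] separates [b] from the other nodes of the connected set [W], so the joint event has
    conditional probability [p1 * p2] given [X a], and uniqueness identifies [p2] with the
    kernel. *)
Lemma markov_one_step (V : finType) (E : {set V * V}) (X : V -> {RV P >-> R})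
    (K : V * V -> R.-pker R ~> R) (W : {set V}) (e : V * V) :
  markov_tree E X -> e \in E -> e.1 \in W -> e.2 \notin W -> linked E W ->
  cond_dist P (X e.1) (X e.2) (K e) -> one_step P K (fun v => X v : T -> R) W e.
Proof.
case: e => a b /= [treeE markov] abE aW bW WL abK A B mA mB.
have mX v : measurable_fun setT (X v : T -> R) by exact: measurable_funP.
have mXB v C : measurable C -> measurable (X v @^-1` C).
  by move=> mC; rewrite -[X in measurable X]setTI; exact: mX.
(* [markov_tree] speaks of non-empty sets, so the case where [W] is just [a] is settled by [abK]
   directly. *)
have [Wa|Wa] := eqVneq (W :\ a)%SET finset.set0.
  have -> : box (fun v => X v : T -> R) W A = X a @^-1` A a.
    apply/seteqP; split => [w /(_ _ aW) //|w wA v vW].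
    have [-> //|va] := eqVneq v a.
    by have := finset.in_set0 v; rewrite -Wa !inE va vW.
  exact: abK.
pose F1 := box (fun v => X v : T -> R) (W :\ a)%SET A.
have mF1 : measurable F1 by exact: measurable_box.
have boxE : box (fun v => X v : T -> R) W A = F1 `&` X a @^-1` A a.
  apply/seteqP; split => [w wA|w [wA wa] v vW].
    by split; [move=> v; rewrite !inE => /andP[_]; exact: wA|exact: wA].
  by have [-> //|va] := eqVneq v a; apply: wA; rewrite !inE va.
have ci : cond_indep P (sigma_of (fun v => X v : T -> R) [set` (W :\ a)%SET])
    (sigma_of (fun v => X v : T -> R) [set` [set b]%SET])
    (sigma_of (fun v => X v : T -> R) [set` [set a]%SET]).
  apply: markov => //; last exact: linked_separates.
  - by apply/set0Pn; exists b; rewrite inE.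
  - by apply/set0Pn; exists a; rewrite inE.
  - rewrite finset.disjoints_subset; apply/fintype.subsetP => v; rewrite !inE => /andP[_ vW].
    by apply: contraNneq bW => <-.
  - rewrite finset.disjoints_subset; apply/fintype.subsetP => v; rewrite !inE.
    by case/andP.
  - rewrite finset.disjoints_subset; apply/fintype.subsetP => v; rewrite !inE => /eqP ->.
    by apply: contraNneq bW => ->.
have sF1 : sigma_of (fun v => X v : T -> R) [set` (W :\ a)%SET] F1.
  have -> : F1 = \bigcap_(v in [set` (W :\ a)%SET]) (X v @^-1` A v).
    by apply/seteqP; split => w wA v vW; exact: wA.
  apply: (@fin_bigcap_measurable _ (g_sigma_algebraType
    (\bigcup_(v in [set` (W :\ a)%SET]) preimage_set_system setT (X v) measurable))) => //.
  move=> v vW; apply: sub_sigma_algebra; exists v => //; exists (A v) => //.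
  by rewrite setTI.
have sF2 : sigma_of (fun v => X v : T -> R) [set` [set b]%SET] (X b @^-1` B).
  apply: sub_sigma_algebra; exists b; first by rewrite /= inE.
  by exists B => //; rewrite setTI.
have [p1 [p2 [P1 P2 [_ i12 P12]]]] := ci _ _ sF1 sF2.
have sm : sigma_of (fun v => X v : T -> R) [set` [set a]%SET] `<=` measurable.
  exact: sigma_of_measurable.
have p2K := cond_prob_unique sm P2 (cond_prob_kernel mX abK mB).
(* This lets [|p1|], a weight that is nonnegative everywhere, replace [p1] under the integrals. *)
have p10 := cond_prob_ge0 sm P1 mF1.
have [_ i1 P1D] := P1.
have mp1 : measurable_fun setT p1 by have /measurable_EFinP := measurable_int _ i1.
pose D := X a @^-1` A a; have mD : measurable D by exact: mXB.
have GC C : measurable C -> sigma_of (fun v => X v : T -> R) [set` [set a]%SET] (X a @^-1` C).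
  move=> mC; apply: sub_sigma_algebra; exists a; first by rewrite /= inE.
  by exists C => //; rewrite setTI.
have mDF : measurable (F1 `&` D) by exact: measurableI.
have mKB : measurable_fun setT (K (a, b) ^~ B) by exact: measurable_kernel.
(* Given X a, the event F1 has conditional probability p1, so on F1 the law of
   X a has the disintegration p1 w * dirac (X a w). *)
rewrite boxE -(integral_image_mrestr P mDF (mX a) mKB) //.
rewrite (@integral_mixture _ _ T R R P D
  (fun w => mscale (NngNum (normr_ge0 (p1 w))) \d_(X a w)) _ mD) //; last first.
- move=> C mC; rewrite /= /pushforward /mrestr.
  have mC' : measurable (D `&` X a @^-1` C) by apply: measurableI => //; exact: mXB.
  rewrite (eq_integral ((fun w => `|p1 w|%:E) \_ (X a @^-1` C))); last first.
    move=> w _; rewrite /mscale /= diracE /patch.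
    have -> : (w \in X a @^-1` C) = (X a w \in C) by apply/idP/idP; rewrite !inE.
    by case: ifP => _; rewrite ?mule1 ?mule0.
  rewrite -integral_mkcondr.
  rewrite (@ae_eq_integral _ _ _ P _ (EFin \o p1)) //.
  - have -> : D `&` X a @^-1` C = X a @^-1` (A a `&` C) by [].
    rewrite P1D; first by congr (P _); apply/seteqP; split => w /=; tauto.
    by apply: GC; exact: measurableI.
  - by apply: measurable_funTS; apply/measurable_EFinP; exact: measurableT_comp mp1.
  - by apply: measurable_funTS; apply/measurable_EFinP.
  - by apply: filterS p10 => w p10 _ /=; rewrite ger0_norm.
- move=> C mC; rewrite /mscale /=; apply: emeasurable_funM.
    by apply/measurable_EFinP; exact: measurableT_comp mp1.
  exact: (measurable_kernel (kdirac (mX a))).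
rewrite (eq_integral (fun w => `|p1 w|%:E * K (a, b) (X a w) B)); last first.
  move=> w _; rewrite ge0_integral_mscale //.
  by rewrite integral_dirac // diracT mul1e.
rewrite (@ae_eq_integral _ _ _ P _ (EFin \o (fun w => p1 w * p2 w)%R)) //.
- rewrite P12; first by congr (P _); apply/seteqP; split => w /=; tauto.
  exact: GC.
- apply: measurable_funTS; apply: emeasurable_funM.
    by apply/measurable_EFinP; exact: measurableT_comp mp1.
  exact: (measurableT_comp mKB (mX a)).
- exact: measurable_funTS (measurable_int _ i12).
- apply: filterS2 p10 p2K => w p10 p2K _ /=.
  by rewrite p2K ger0_norm // EFinM fineK //; exact: pker_fin_num.
Qed.

End markov_step.

(** * The multiplicative limit tree *)

Section limit_tree.
Variables (V : finType) (R : realType) (mu : V * V -> probability R R).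

Let measurable_mul : measurable_fun setT (fun p : R * R => p.1 * p.2).
Proof. by apply: measurable_funM; [exact: measurable_fst|exact: measurable_snd]. Qed.

(* the transition kernels of the multiplicative tree theta *)
Definition limit_kernel (e : V * V) : R.-pker R ~> R :=
  kpush (kprobability (measurable_cst (mu e : pprobability R R)) : R.-pker R ~> R)
    measurable_mul.

Lemma limit_kernelE e x B : limit_kernel e x B = mu e [set m | B (x * m)].
Proof. by []. Qed.

Context d (T : measurableType d) (Q : probability T R).
Variables (E : {set V * V}) (u : V) (M : V * V -> {RV Q >-> R}).
Hypotheses (treeE : undirected_tree E)
  (indM : mutually_independent (edges_from E u) M)
  (lawM : forall e, e \in edges_from E u -> forall B, measurable B ->
    distribution Q (M e) B = mu e B).

(** On such a set [theta] depends only on the factors of edges ending in [W], so it is independent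
    of the factor of an edge leaving [W]. *)
Definition path_closed (W : {set V}) := forall v e, v \in W -> e \in tree_path E u v ->
  e \in edges_from E u /\ e.2 \in W.

Lemma path_closed1 : path_closed [set u]%SET.
Proof. by move=> v e; rewrite !inE => /eqP ->; rewrite tree_path_refl // inE. Qed.

Lemma path_closedU1 W e : path_closed W -> e \in edges_from E u -> e.1 \in W ->
  path_closed (e.2 |: W).
Proof.
move=> WP eu aW v f; rewrite !finset.in_setU1 => /orP[/eqP ->|vW fv].
  have [-> _] := tree_path_edges_from treeE eu.
  rewrite finset.in_setU1 => /orP[/eqP ->|fa]; first by rewrite eqxx.
  by have [fu fW] := WP _ _ aW fa; rewrite fW orbT.
by have [fu fW] := WP _ _ vW fv; rewrite fW orbT.
Qed.

Let th (x : rvec ((V * V)%type : finType) R) (v : V) : R :=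
  if v == u then 1 else \prod_(e in tree_path E u v) x e.

Let measurable_th v : measurable_fun setT (th ^~ v).
Proof.
rewrite /th; case: (v == u); first exact: measurable_cst.
under eq_fun do rewrite -big_enum.
by apply: measurable_prod => e _; exact: measurable_coord.
Qed.

Lemma theta_edge e w : e \in edges_from E u ->
  theta E u M w e.2 = theta E u M w e.1 * M e w.
Proof.
move=> eu; have [te ne] := tree_path_edges_from treeE eu.
rewrite /theta (negPf (edges_from_target treeE eu)) te big_setU1 //= mulrC.
congr (_ * _); case: eqP => // ->.
by rewrite tree_path_refl // big_set0.
Qed.

Lemma measurable_theta v : measurable_fun setT (fun w => theta E u M w v).
Proof.
rewrite /theta; case: (v == u); first exact: measurable_cst.
under eq_fun do rewrite -big_enum.
by apply: measurable_prod => e _; exact: measurable_funP.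
Qed.

(** Independence is expressed by a constant kernel as conditional distribution. *)
Lemma cond_dist_indep (J : {set V * V}) e : J \subset edges_from E u ->
  e \in edges_from E u -> e \notin J ->
  cond_dist Q (fun w => (fun f => if f \in J then M f w else 0) : rvec ((V * V)%type : finType) R)
    (M e) (kprobability (measurable_cst (mu e : pprobability R R))).
Proof.
move=> JE eE eJ; set Z := (X in cond_dist _ X).
have mM f B : measurable B -> measurable (M f @^-1` B).
  by move=> mB; rewrite -[X in measurable X]setTI; exact: measurable_funP.
have mZ : measurable_fun setT Z.
  apply: measurable_rvec => f; rewrite /Z; case: (f \in J).
    exact: measurable_funP.
  exact: measurable_cst.
apply: cond_dist_cylinders => //.
move=> A B mA mB.
have mZA : measurable (Z @^-1` cylinder A).
  by rewrite -[X in measurable X]setTI; apply: mZ => //; exact: measurable_cylinder.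
transitivity (\int[Q]_(w in Z @^-1` cylinder A) (cst (mu e B) w))%E; last by [].
rewrite integral_cst //.
(* Coordinates outside [J] are padded with 0: a cylinder excluding this value there gives the empty
   event, any other imposes nothing there. *)
have [A0|A0] := pselect (forall f, f \notin J -> A f 0); last first.
  have -> : Z @^-1` cylinder A = set0.
    apply/seteqP; split => // w ZA; apply: A0 => f fJ.
    by have := ZA f; rewrite /Z (negPf fJ).
  by rewrite set0I !measure0 mule0.
have -> : Z @^-1` cylinder A = \bigcap_(f in [set` J]) (M f @^-1` A f).
  apply/seteqP; split => w wA f.
    by move=> fJ; have := wA f; rewrite /Z fJ.
  by rewrite /Z; case: ifPn => fJ; [exact: wA|exact: A0].
pose B' f := if f == e then B else A f.
have B'J f : f \in J -> B' f = A f.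
  by move=> fJ; rewrite /B'; case: eqP => // fe; rewrite -fe fJ in eJ.
have B'e : B' e = B by rewrite /B' eqxx.
have mB' f : measurable (B' f) by rewrite /B'; case: ifP.
have -> : (\bigcap_(f in [set` J]) (M f @^-1` A f)) `&` M e @^-1` B =
    \bigcap_(f in [set` (e |: J)%SET]) (M f @^-1` B' f).
  apply/seteqP; split => [w [wA wB] f|w wA].
    by rewrite /= !inE => /orP[/eqP ->|fJ]; rewrite ?B'e ?B'J //; exact: wA.
  split; last by have := wA e; rewrite B'e; apply; rewrite /= !inE eqxx.
  by move=> f fJ; have := wA f; rewrite B'J //; apply; rewrite /= !inE fJ orbT.
rewrite indM //; last by rewrite finset.subUset finset.sub1set eE.
rewrite big_setU1 //= EFinM B'e -lawM //; congr (_ * _)%E.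
  by rewrite fineK // fin_num_measure //; exact: mM.
etransitivity; last exact/esym/(indM JE mA).
by congr (_%:E); apply: eq_bigr => f fJ; rewrite B'J.
Qed.

(** The value at [e.1] is a function of the factors in [J]; multiplying it by the independent [M e]
    is a draw from [limit_kernel e]. *)
Lemma theta_one_step W e : path_closed W -> e \in edges_from E u -> e.1 \in W ->
  e.2 \notin W -> one_step Q limit_kernel (fun v w => theta E u M w v) W e.
Proof.
move=> WP eu aW bW A B mA mB.
pose J := [set f in edges_from E u | f.2 \in W].
pose Z w : rvec ((V * V)%type : finType) R := fun f => if f \in J then M f w else 0.
have eJ : e \notin J by rewrite inE eu (negPf bW).
have JE : J \subset edges_from E u.
  by apply/fintype.subsetP => f; rewrite inE => /andP[].
have mZ : measurable_fun setT Z.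
  apply: measurable_rvec => f; rewrite /Z; case: (f \in J).
    exact: measurable_funP.
  exact: measurable_cst.
have thE v w : v \in W -> theta E u M w v = th (Z w) v.
  move=> vW; rewrite /theta /th; case: eqP => // _; apply: eq_bigr => f fv.
  by have [fu fW] := WP _ _ vW fv; rewrite /Z inE fu fW.
have mg : measurable_fun setT (fun p : rvec ((V * V)%type : finType) R * R => th p.1 e.1 * p.2).
  apply: measurable_funM; last exact: measurable_snd.
  exact: (measurableT_comp (measurable_th e.1) measurable_fst).
have mM : measurable_fun setT (M e : T -> R) by exact: measurable_funP.
have := cond_dist_push mg mZ mM (cond_dist_indep JE eu eJ).
pose A' := \bigcap_(v in [set` W]) ((th ^~ v) @^-1` A v).
have mA' : measurable A'.
  apply: fin_bigcap_measurable => // v _.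
  by rewrite -[X in measurable X]setTI; exact: measurable_th.
move=> /(_ A' B mA' mB).
have -> : Z @^-1` A' = box (fun v w => theta E u M w v) W A.
  apply/seteqP; split => w wA v vW; first by rewrite thE //; exact: wA.
  by rewrite /= -thE //; exact: wA.
have -> : (fun w => th (Z w) e.1 * M e w) = (fun w => theta E u M w e.2).
  by apply/funext => w; rewrite theta_edge // thE.
by move=> ->; apply: eq_integral => w _; rewrite limit_kernelE thE.
Qed.

(** [theta] equals 1 at [u], so the conditional law given this coordinate is evaluated at 1 only,
    and the integral of a constant remains. *)
Lemma theta_law B : measurable B ->
  pushforward Q (theta E u M) B = cond_law limit_kernel E u 1 B.
Proof.
move=> mB.
have := cond_dist_cond_law measurable_theta path_closed1
  (fun W e WP eu aW _ => path_closedU1 WP eu aW) theta_one_step treeE.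
move=> /(_ setT B measurableT mB); rewrite preimage_setT setTI => QB; etransitivity; first exact: QB.
rewrite (eq_integral (cst (cond_law limit_kernel E u 1 B))); last first.
  by move=> w _; rewrite /theta eqxx.
by rewrite integral_cst // [X in (_ * X)%E]probability_setT mule1.
Qed.

End limit_tree.

(** * Convergence along the tree *)

Lemma ler_dist_itv (R : realDomainType) (C a b : R) :
  0 <= a <= C -> 0 <= b <= C -> `|a - b| <= C.
Proof. by move=> /andP[? ?] /andP[? ?]; rewrite ler_norml; apply/andP; split; lra. Qed.

Section expectation_along_edges.
Variables (V : finType) (R : realType) (K : V * V -> R.-pker R ~> R).
Variables (F : rvec V R -> R) (C : R).
Hypotheses (mF : measurable_fun setT F) (F0 : forall z, 0 <= F z)
  (FC : forall z, F z <= C).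

Definition expect (s : seq (V * V)) (x : rvec V R) : R :=
  \int[edges_kernel K s x]_y F y.

Let FnormC z : `|F z| <= C. Proof. by rewrite ger0_norm. Qed.

Lemma expectE s x : (\int[edges_kernel K s x]_y (F y)%:E)%E = (expect s x)%:E.
Proof. exact: (integral_bounded (klaw (edges_kernel K s) x) mF FnormC). Qed.

Lemma expect_ge0 s x : 0 <= expect s x.
Proof. exact: Rintegral_ge0. Qed.

Lemma expect_le s x : expect s x <= C.
Proof.
have -> : C = \int[klaw (edges_kernel K s) x]_y C.
  transitivity (C * fine (edges_kernel K s x setT)); first by rewrite prob_kernel mulr1.
  by rewrite Rintegral_cst.
apply: le_Rintegral => //.
  exact: (integrable_bounded (klaw (edges_kernel K s) x) mF FnormC).
exact: (integrable_bounded (klaw (edges_kernel K s) x) (C := `|C|)).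
Qed.

Lemma expect_norm s x : `|expect s x| <= C.
Proof. by rewrite ger0_norm ?expect_ge0 // expect_le. Qed.

Let mFE : measurable_fun setT (EFin \o F).
Proof. exact/measurable_EFinP. Qed.

Let FE0 y : (0 <= (EFin \o F) y)%E. Proof. by rewrite lee_fin. Qed.

Lemma measurable_expect s : measurable_fun setT (expect s).
Proof.
apply: measurableT_comp => //; apply: measurable_fun_integral_kernel => //.
exact: measurable_kernel.
Qed.

Lemma expect_nil x : expect [::] x = F x.
Proof. by rewrite /expect /Rintegral integral_dirac // diracT mul1e. Qed.

Lemma expect_cons e s x : (expect (e :: s) x)%:E =
  (\int[K e (x e.1)]_y (expect s (upd x e.2 y))%:E)%E.
Proof.
rewrite -expectE /= (@integral_mixture _ _ _ _ R
  (edge_kernel (K e) e.1 e.2 x) setT (edges_kernel K s) _ measurableT) //; last first.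
  by move=> B mB; exact: measurable_kernel.
under eq_integral do rewrite expectE.
rewrite ge0_integral_pushforward //.
- exact: measurable_updr.
- by apply/measurable_EFinP; exact: measurable_expect.
- by move=> y _; rewrite lee_fin expect_ge0.
Qed.

Lemma integral_cond_law (E : {set V * V}) u t :
  (\int[cond_law K E u t]_y (F y)%:E)%E =
  (expect (ordered_edges_from E u) (fun=> t))%:E.
Proof.
rewrite (@integral_mixture _ _ _ _ R
  (kdirac (@measurable_constant V R) t) setT (edges_kernel K (ordered_edges_from E u))
  _ measurableT) //; last first.
  by move=> B mB; exact: measurable_kernel.
under eq_integral do rewrite expectE.
rewrite integral_dirac ?diracT ?mul1e //.
by apply/measurable_EFinP; exact: measurable_expect.
Qed.

End expectation_along_edges.

Section laws_on_half_line.
Variable R : realType.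

Lemma eq_integral_nonneg (m : {measure set R -> \bar R}) (f g : R -> R) :
  m setT = 1%E -> m [set y | 0 <= y] = 1%E ->
  measurable_fun setT f -> measurable_fun setT g ->
  (forall y, 0 <= y -> f y = g y) ->
  (\int[m]_y (f y)%:E = \int[m]_y (g y)%:E)%E.
Proof.
move=> m1 mnng mf mg fg; apply: ae_eq_integral => //; try exact/measurable_EFinP.
have mnn : measurable [set y : R | 0 <= y].
  by rewrite (_ : [set y | _] = `[0, +oo[%classic) //; apply/seteqP; split => y; rewrite /= in_itv /= andbT.
exists (~` [set y | 0 <= y]); split; first exact: measurableC.
- rewrite -setTD measureD // ?setTI; last first.
    by apply: le_lt_trans (ltry 1); rewrite -m1.
  transitivity (1 - 1 : \bar R)%E; last by rewrite subee.
  by congr (_ - _)%E; [exact: m1|exact: mnng].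
- by move=> y fgy y0; apply: fgy => _ /=; rewrite fg.
Qed.

Let measurable_divr (r : R) : measurable_fun setT (fun y : R => y / r).
Proof. exact: measurable_funM. Qed.

Definition ratio_law (k : R.-pker R ~> R) (x : R) : set R -> \bar R :=
  pushforward (k x) (fun y => y / x).

HB.instance Definition _ k x :=
  Measure.copy (ratio_law k x) (image_measure (k x) (measurable_divr x)).

Let ratio_law_setT k x : ratio_law k x setT = 1%E.
Proof. by rewrite /ratio_law /pushforward preimage_setT prob_kernel. Qed.

HB.instance Definition _ k x :=
  Measure_isProbability.Build _ _ _ (ratio_law k x) (ratio_law_setT k x).

Lemma integral_ratio_law k x (f : R -> R) : measurable_fun setT f ->
  (forall y, 0 <= f y) ->
  (\int[ratio_law k x]_y (f y)%:E = \int[k x]_y (f (y / x))%:E)%E.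
Proof.
move=> mf f0; rewrite ge0_integral_pushforward //.
- exact/measurable_EFinP.
- by move=> y _; rewrite lee_fin.
Qed.

End laws_on_half_line.

Section scaling_limit.
Variables (V : finType) (R : realType) (E : {set V * V}) (u : V)
  (K : V * V -> R.-pker R ~> R) (mu : V * V -> probability R R).
Hypotheses (treeE : undirected_tree E)
  (K_nonneg : forall e, e \in edges_from E u ->
    forall x, 0 <= x -> K e x [set y | 0 <= y] = 1%E)
  (mu_nonneg : forall e, e \in edges_from E u -> mu e [set y | 0 <= y] = 1%E)
  (K_weak : forall e, e \in edges_from E u ->
    weak_cvg (fun x => pushforward (K e x) (fun y => y / x)) +oo (mu e))
  (K_small : forall e, e \in edges_from E u -> e.1 != u ->
    (exists2 e', e' \in tree_path E u e.1 & (0 < mu e' [set 0%R])%E) ->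
    forall eta : R, 0 < eta ->
      limf_esup (fun x : R => ereal_sup
          [set K e (eps * x) [set y | eta < y / x] | eps in [set eps | 0 <= eps <= delta]]) +oo
        @[delta --> 0^'+] --> 0%E).
Variables (F : rvec V R -> R) (C : R).
Hypotheses (mF : measurable_fun setT F) (F0 : forall z, 0 <= F z)
  (FC : forall z, F z <= C)
  (F_scale : forall t z, 0 < t -> F (fun v => t * z v) = F z)
  (F_cont : forall z : rvec V R, z u != 0 -> {for z, continuous F}).

(* The nodes v such that theta v is almost surely positive; they include u. *)
Definition pos_node v := forall e, e \in tree_path E u v -> mu e [set 0] = 0%E.

Implicit Types (e : V * V) (z w : rvec V R) (t : R) (s : seq (V * V)) (W : {set V}).

(** Zeros are tolerated only at nodes whose outgoing edges are covered by (ii). As [u] is a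
    [pos_node], a vector good on a set containing [u] is a point of continuity of [F]. *)
Definition good (W : {set V}) (z : rvec V R) :=
  forall v, v \in W -> pos_node v -> z v != 0.

(* Absolute values allow limits at nonnegative vectors to be taken along all
   vectors. *)
Definition absv (z : rvec V R) : rvec V R := fun v => `|z v|.

Definition scale (t : R) (z : rvec V R) : rvec V R := fun v => t * z v.

Notation at_oo z := (filter_prod (pinfty_nbhs R) (nbhs (z : rvec V R))).
Notation G := (expect K F).
Notation Gl := (expect (limit_kernel mu) F).

Lemma near_fst z (A : set R) : (\forall t \near +oo, A t) -> \forall i \near at_oo z, A i.1.
Proof. by move=> tA; exists (A, setT) => [|i []] //=; split=> //; exact: filterT. Qed.

Lemma near_snd z (B : set (rvec V R)) : nbhs z B -> \forall i \near at_oo z, B i.2.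
Proof. by move=> zB; exists (setT, B) => [|i []] //=; split=> //; exact: filterT. Qed.

Lemma cvg_at_oo (I : Type) (H : set_system I) (f : I -> R) (g : I -> rvec V R) z :
  Filter H -> f @ H --> +oo -> g @ H --> z -> (f i, g i) @[i --> H] --> at_oo z.
Proof.
move=> FH foo gz A [[B D] [/= FB zD] BD].
have fB : H [set i | B (f i)] := foo _ FB.
have gD : H [set i | D (g i)] := gz _ zD.
change (H [set i | A (f i, g i)]).
by apply: filterS2 fB gD => i Bi Di; exact: (BD (f i, g i)).
Qed.

Lemma norm_coord_cvg z v : `|w v| @[w --> z] --> `|z v|.
Proof. exact: (cvg_norm (@coord_continuous V R v z)). Qed.

Let measurable_max_divr t : measurable_fun setT (fun y : R => `|Num.max (y / t) 0|).
Proof.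
by apply: measurableT_comp => //; apply: measurable_maxr => //; exact: measurable_funM.
Qed.

Let measurable_cmul (c : R) : measurable_fun setT (fun m : R => c * m).
Proof. exact: measurable_funM. Qed.

Lemma pos_node_root : pos_node u.
Proof. by move=> e; rewrite tree_path_refl // inE. Qed.

Lemma pos_node_edge e : e \in edges_from E u -> pos_node e.2 ->
  pos_node e.1 /\ mu e [set 0] = 0%E.
Proof.
move=> eu; have [te _] := tree_path_edges_from treeE eu.
rewrite /pos_node te => pe; split=> [f fe|]; apply: pe.
  by rewrite finset.in_setU1 fe orbT.
by rewrite finset.in_setU1 eqxx.
Qed.

Lemma not_pos_node v : ~ pos_node v -> v != u /\
  exists2 e, e \in tree_path E u v & (0 < mu e [set 0%R])%E.
Proof.
move=> pv; split; first by apply/eqP => vu; apply: pv; rewrite vu; exact: pos_node_root.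
apply: contrapT => npv; apply: pv => e ev; apply/eqP; rewrite eq_le measure_ge0 andbT leNgt.
by apply/negP => mu0; apply: npv; exists e.
Qed.

Lemma good_upd (W : {set V}) z e y : good W z -> (pos_node e.2 -> y != 0) ->
  good (e.2 |: W) (upd z e.2 y).
Proof.
move=> Wz by0 v; rewrite finset.in_setU1 /upd.
by case: eqP => [-> _|_ /= vW]; [exact: by0|exact: Wz].
Qed.

Lemma upd_cvg (I : Type) (H : set_system I) (f : I -> rvec V R) (g : I -> R) b z y :
  Filter H -> f @ H --> z -> g @ H --> y -> upd (f i) b (g i) @[i --> H] --> upd z b y.
Proof.
move=> FH fz gy; apply: rvec_cvg => v; rewrite /upd; case: (v == b) => //.
exact: (cvg_comp _ _ fz (@coord_continuous V R v z)).
Qed.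

Lemma limit_kernel_integral e s x : e \in edges_from E u ->
  (Gl (e :: s) x)%:E = (\int[mu e]_m (Gl s (upd x e.2 (x e.1 * m)))%:E)%E.
Proof.
move=> eu; rewrite (expect_cons _ mF F0 FC).
have mG : measurable_fun setT (fun y => (Gl s (upd x e.2 y))%:E).
  apply/measurable_EFinP; apply: measurableT_comp (measurable_updr _ _).
  exact: (measurable_expect _ mF F0).
rewrite ge0_integral_pushforward //.
- exact: measurable_cmul.
- by move=> y _; rewrite lee_fin (expect_ge0 _ F0).
Qed.

(** Negative draws have probability 0. They are clipped so that the one-sided bound on the draw in
    (ii) also bounds its absolute value. *)
Lemma prelimit_integral e s t z : e \in edges_from E u -> 0 < t ->
  (G (e :: s) (scale t (absv z)))%:E =
  (\int[K e (t * `|z e.1|)%R]_y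
     (G s (scale t (absv (upd z e.2 (Num.max (y / t) 0))))%R)%:E)%E.
Proof.
move=> eu t0; rewrite (expect_cons _ mF F0 FC).
have x0 : 0 <= t * `|z e.1| by rewrite mulr_ge0 // ltW.
have mmax : measurable_fun setT (fun y : R => Num.max (y / t) 0).
  by apply: measurable_maxr => //; exact: measurable_funM.
apply: eq_integral_nonneg => //.
- exact: prob_kernel.
- exact: K_nonneg.
- apply: measurableT_comp (measurable_updr _ _); exact: (measurable_expect _ mF F0).
- apply: measurableT_comp.
    exact: (measurable_expect _ mF F0).
  apply: measurable_rvec => v; rewrite /scale /absv /upd.
  case: (v == e.2); last exact: measurable_cst.
  by apply: measurableT_comp (measurable_cmul _) _; exact: measurableT_comp.
- move=> y y0; congr (expect _ _ _ _); apply/funext => v.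
  rewrite /scale /absv /upd; case: eqP => // _.
  have yt : 0 <= y / t by rewrite divr_ge0 // ltW.
  by rewrite (max_l yt) (ger0_norm yt) mulrC divfK // gt_eqF.
Qed.

Lemma base_cvg z : z u != 0 ->
  G [::] (scale i.1 (absv i.2)) @[i --> at_oo z] --> Gl [::] (absv z).
Proof.
move=> zu; rewrite (expect_nil _ mF).
have az : absv i.2 @[i --> at_oo z] --> absv z.
  apply: rvec_cvg => v; apply: cvg_norm.
  exact: (cvg_comp _ _ (@cvg_snd _ _ (pinfty_nbhs R) (nbhs z) _) (@coord_continuous V R v z)).
have azu : absv z u != 0 by rewrite /absv normr_eq0.
apply: cvg_trans (cvg_comp _ _ az (F_cont azu)); apply: near_eq_cvg.
have t0 : \forall i \near at_oo z, 0 < i.1.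
  by apply: (@near_fst z (fun t => 0 < t)); exact: nbhs_pinfty_gt.
by apply: filterS t0 => i t0 /=; rewrite (expect_nil _ mF) /scale F_scale.
Qed.

Lemma scale_at_oo z a : z a != 0 -> i.1 * `|i.2 a| @[i --> at_oo z] --> +oo.
Proof.
move=> za; apply/cvgryPge => A; pose r := `|z a| / 2.
have r0 : 0 < r by rewrite divr_gt0 // normr_gt0.
have zr : \forall i \near at_oo z, r <= `|i.2 a|.
  apply: (@near_snd z (fun w => r <= `|w a|)).
  apply: (cvgr_ge _ (norm_coord_cvg (v := a))).
  by rewrite /r ltr_pdivrMr // ltr_pMr ?normr_gt0 // ltr1n.
have tA : \forall i \near at_oo z, `|A| / r <= i.1.
  by apply: (@near_fst z (fun t => `|A| / r <= t)); apply: nbhs_pinfty_ge; exact: num_real.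
apply: filterS2 zr tA => i zr tA.
have rn : r != 0 by rewrite gt_eqF.
rewrite (le_trans (ler_norm A)) // -[leLHS](divfK rn).
by rewrite ler_pM // ?divr_ge0 // ltW.
Qed.

(** With [m] the ratio of the draw to its starting value [t * |w a|], the new coordinate is
    [|w a| * m]. The starting value tends to infinity, so the law of [m] converges to [mu e]. *)
Lemma step_cvg_pos e s (W : {set V}) z : e \in edges_from E u -> e.1 \in W ->
  (forall z', good (e.2 |: W) z' ->
    G s (scale i.1 (absv i.2)) @[i --> at_oo z'] --> Gl s (absv z')) ->
  good W z -> z e.1 != 0 ->
  G (e :: s) (scale i.1 (absv i.2)) @[i --> at_oo z] --> Gl (e :: s) (absv z).
Proof.
move=> eu aW IH Wz za; pose a := e.1; pose b := e.2.
pose H_ (i : R * rvec V R) m := G s (scale i.1 (absv (upd i.2 b (`|i.2 a| * m)))).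
pose H m := Gl s (absv (upd z b (`|z a| * m))).
(* m = 0 is excluded if e.2 is a pos_node, since it destroys good; it is then
   mu e-negligible. *)
pose dlt (m : R) := if `[< pos_node b >] then `|m| else 1.
have mabs (c : R) : measurable_fun setT (fun m : R => `|c * m|).
  by apply: measurableT_comp => //; exact: measurable_cmul.
have mupd (c t : R) (w : rvec V R) :
    measurable_fun setT (fun m => scale t (absv (upd w b (c * m)))).
  apply: measurable_rvec => v; rewrite /scale /absv /upd.
  case: (v == b); last exact: measurable_cst.
  exact: (measurableT_comp (measurable_cmul t) (mabs c)).
have mupd1 (c : R) (w : rvec V R) : measurable_fun setT (fun m => absv (upd w b (c * m))).
  apply: measurable_rvec => v; rewrite /absv /upd.
  case: (v == b); last exact: measurable_cst.
  exact: mabs.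
have mH_ i : measurable_fun setT (H_ i).
  by apply: measurableT_comp (mupd _ _ _); exact: (measurable_expect _ mF F0).
have mH : measurable_fun setT H.
  by apply: measurableT_comp (mupd1 _ _); exact: (measurable_expect _ mF F0).
have limit : (\int[ratio_law (K e) (i.1 * `|i.2 a|)%R]_m (H_ i m)%:E)%E @[i --> at_oo z] -->
    (\int[mu e]_m (H m)%:E)%E.
  apply: (@extended_mapping _ _ _ (fun i => ratio_law (K e) (i.1 * `|i.2 a|)) (mu e)
    H_ H dlt C) => //.
  - rewrite /dlt; case: asboolP => _ m; [exact: norm_continuous|exact: cvg_cst].
  - by move=> m; rewrite /dlt; case: ifP.
  - rewrite /dlt; case: asboolP => [pb|_].
      have [_ mu0] := pos_node_edge eu pb.
      rewrite -mu0; congr (mu e _); apply/seteqP; split => m /=; last by move=> ->; rewrite normr0.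
      by move/eqP; rewrite normr_eq0 => /eqP.
    rewrite (_ : [set _ | _] = set0) ?measure0 //.
    by apply/seteqP; split => m //= /eqP; rewrite oner_eq0.
  - move=> phi cphi bphi.
    exact: (cvg_comp _ _ (scale_at_oo za) (K_weak eu cphi bphi)).
  - by move=> i y; exact: (expect_norm _ mF F0 FC).
  - by move=> y; exact: (expect_norm _ mF F0 FC).
  - move=> m dm.
    have gb : good (b |: W) (upd z b (`|z a| * m)).
      apply: good_upd => // pb; rewrite mulf_eq0 normr_eq0 (negPf za) /=.
      by move: dm; rewrite /dlt asboolT // normr_gt0.
    pose h (p : R * rvec V R * R) := (p.1.1, upd p.1.2 b (`|p.1.2 a| * p.2)).
    apply: (@cvg_comp _ _ _ h (fun i => G s (scale i.1 (absv i.2))) _ _ _ _ (IH _ gb)).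
    have z1 : p.1.2 @[p --> filter_prod (at_oo z) (nbhs m)] --> z.
      by apply: (@cvg_comp _ _ _ fst snd _ (at_oo z)); [exact: cvg_fst|exact: cvg_snd].
    apply: cvg_at_oo.
      by apply: (@cvg_comp _ _ _ fst fst _ (at_oo z)); [exact: cvg_fst|exact: cvg_fst].
    apply: upd_cvg => //; apply: cvgM; last exact: cvg_snd.
    apply: cvg_norm; exact: (cvg_comp _ _ z1 (@coord_continuous V R a z)).
have limE : (\int[mu e]_m (H m)%:E)%E = (Gl (e :: s) (absv z))%:E.
  rewrite (limit_kernel_integral _ _ eu); apply: eq_integral_nonneg.
  - exact: probability_setT.
  - exact: mu_nonneg.
  - exact: mH.
  - apply: measurableT_comp; first exact: (measurable_expect _ mF F0).
    apply: measurable_rvec => v; rewrite /upd; case: (v == _); last exact: measurable_cst.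
    exact: measurable_cmul.
  - move=> m m0; congr (expect _ _ _ _); apply/funext => v; rewrite /absv /upd.
    by case: eqP => // _; rewrite normrM normr_id (ger0_norm m0).
have near_t0 : \forall i \near at_oo z, 0 < i.1.
  by apply: (@near_fst z (fun t => 0 < t)); exact: nbhs_pinfty_gt.
have near_x0 : \forall i \near at_oo z, 0 < i.1 * `|i.2 a|.
  by move/cvgryPgt : (scale_at_oo za); apply.
(* The integrands agree at nonnegative draws [y] through [m = y / (t * |w a|)]. *)
have preE : {near at_oo z, (fun i => (\int[ratio_law (K e) (i.1 * `|i.2 a|)%R]_m (H_ i m)%:E)%E) =1
    (fun i => (G (e :: s) (scale i.1 (absv i.2)))%:E)}.
  apply: filterS2 near_t0 near_x0 => i t0 x0.
  have H0 y : 0 <= H_ i y by exact: expect_ge0.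
  have ratio := integral_ratio_law (K e) (i.1 * `|i.2 a|) (mH_ i) H0.
  refine (etrans ratio (etrans _ (esym (prelimit_integral s i.2 eu t0)))).
  apply: eq_integral_nonneg.
  - exact: prob_kernel.
  - by apply: K_nonneg => //; exact: ltW.
  - by apply: measurableT_comp => //; exact: measurable_funM.
  - apply: measurableT_comp; first exact: (measurable_expect _ mF F0).
    apply: measurable_rvec => v; rewrite /scale /absv /upd.
    case: (v == e.2); last exact: measurable_cst.
    apply: measurableT_comp (measurable_cmul _) _; apply: measurableT_comp => //.
    by apply: measurable_maxr => //; exact: measurable_funM.
  - move=> y y0; congr (expect _ _ _ _); apply/funext => v.
    rewrite /scale /absv /upd /b; case: eqP => // _; congr (_ * `|_|).
    have yt : 0 <= y / i.1 by rewrite divr_ge0 // ltW.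
    have wa : `|i.2 a| != 0 by apply: contraTneq x0 => ->; rewrite mulr0 ltxx.
    by rewrite (max_l yt); field; rewrite wa gt_eqF.
rewrite limE in limit.
have lim : (G (e :: s) (scale i.1 (absv i.2)))%:E @[i --> at_oo z] -->
    (Gl (e :: s) (absv z))%:E.
  exact: cvg_trans (near_eq_cvg preE) limit.
by case/fine_cvgP: lim.
Qed.

(** The starting value is only known to be at most [delta * t], and (ii) is uniform over such
    values. As [e.1] is not a [pos_node], neither is [e.2], so [good] permits the limit value 0
    there. *)
Lemma step_cvg_zero e s (W : {set V}) z : e \in edges_from E u -> e.1 \in W ->
  (forall z', good (e.2 |: W) z' ->
    G s (scale i.1 (absv i.2)) @[i --> at_oo z'] --> Gl s (absv z')) ->
  good W z -> z e.1 = 0 ->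
  G (e :: s) (scale i.1 (absv i.2)) @[i --> at_oo z] --> Gl (e :: s) (absv z).
Proof.
move=> eu aW IH Wz za.
have npa : ~ pos_node e.1 by move=> pa; have := Wz _ aW pa; rewrite za eqxx.
have [au zero] := not_pos_node npa.
have npb : ~ pos_node e.2 by move=> /(pos_node_edge eu)[].
have gb : good (e.2 |: W) (upd z e.2 0) by exact: good_upd.
pose h := Gl s (absv (upd z e.2 0)).
have limE : Gl (e :: s) (absv z) = h.
  apply: EFin_inj; rewrite limit_kernel_integral // (eq_integral (cst h%:E)).
    by rewrite integral_cst // [X in (_ * X)%E]probability_setT mule1.
  move=> m _; rewrite /absv za normr0 mul0r; congr (expect _ _ _ _)%:E.
  by apply/funext => v; rewrite /upd /absv; case: eqP; rewrite ?normr0.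
rewrite limE; apply/cvgrPdist_le => ep ep0.
have C0 : 0 <= C by exact: le_trans (F0 z) (FC z).
(* [c] bounds both the error while the draw is small and the probability that it is not, which costs
   at most [C]; the total is [c + C * c = ep]. *)
pose c := ep / (1 + C).
have c0 : 0 < c by rewrite divr_gt0 // ltr_pwDl.
have /cvgrPdist_le/(_ _ c0) [[A U] [/= tA zU] AU] := IH _ gb.
have [eta eta0 [U' zU' etaU]] : exists2 eta, 0 < eta & exists2 U', nbhs z U' &
    forall w y, U' w -> `|y| <= eta -> U (upd w e.2 y).
  have updc : upd p.1 e.2 p.2 @[p --> filter_prod (nbhs z) (nbhs (0 : R))] --> upd z e.2 0.
    by apply: upd_cvg; [exact: cvg_fst|exact: cvg_snd].
  have [[U' D] [/= zU' /nbhs_ballP [r /= r0 rD]] UD] := updc _ zU.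
  exists (r / 2); first by rewrite divr_gt0.
  exists U' => // w y Uw yr; apply: (UD (w, y)); split => //=; apply: rD.
  rewrite /ball /= sub0r normrN (le_lt_trans yr) // ltr_pdivrMr //.
  by rewrite ltr_pMr // ltr1n.
(* A limit superior below [c] for one [delta] gives a bound valid for all large [t]. *)
have [delta d0 Kd] : exists2 delta, 0 < delta & \forall t \near +oo,
    forall eps, 0 <= eps <= delta -> (K e (eps * t)%R [set y | (eta < y / t)%R] <= c%:E)%E.
  have small := K_small eu au zero eta0.
  have sc : nbhs (0 : \bar R)%E [set y | (y < c%:E)%E].
    by apply: open_nbhs_nbhs; split; [exact: open_ereal_lt_ereal|rewrite /= lte_fin].
  have [delta [dpos /ereal_inf_lt[_ [B tB <-] supB]]] :=
    filter_ex (filterI (nbhs_right_gt (0 : R)) (small _ sc)).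
  exists delta => //; apply: filterS tB => t Bt eps epsd.
  apply: le_trans (ltW supB); apply: le_trans (ereal_sup_ubound _); last by exists t.
  by apply: ereal_sup_ubound; exists eps.
have wd : \forall w \near z, `|w e.1| <= delta.
  by apply: (cvgr_le _ (norm_coord_cvg (v := e.1))); rewrite za normr0.
have near_t : \forall i \near at_oo z, [/\ A i.1, 0 < i.1 &
    forall eps, 0 <= eps <= delta -> (K e (eps * i.1)%R [set y | (eta < y / i.1)%R] <= c%:E)%E].
  apply: (@near_fst z (fun t => [/\ A t, 0 < t & forall eps, 0 <= eps <= delta ->
    (K e (eps * t)%R [set y | (eta < y / t)%R] <= c%:E)%E])).
  by apply: filterS3 tA (nbhs_pinfty_gt (num_real 0)) Kd.
have near_w : \forall i \near at_oo z, U' i.2 /\ `|i.2 e.1| <= delta.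
  by apply: (@near_snd z (fun w => U' w /\ `|w e.1| <= delta)); exact: filterI.
apply: filterS2 near_t near_w => -[t w] /= [At t0 Kt] [Uw wdelta].
pose k := klaw (K e) (t * `|w e.1|).
pose f y := G s (scale t (absv (upd w e.2 (Num.max (y / t) 0)))).
have mf : measurable_fun setT f.
  apply: measurableT_comp; first exact: (measurable_expect _ mF F0).
  apply: measurable_rvec => v; rewrite /scale /absv /upd.
  case: (v == e.2); last exact: measurable_cst.
  exact: (measurableT_comp (measurable_cmul t) (measurable_max_divr t)).
have GE : G (e :: s) (scale t (absv w)) = \int[k]_y f y.
  by rewrite -[LHS]/(fine _%:E) prelimit_integral.
have hE : h = \int[k]_y (cst h) y.
  transitivity (h * fine (k setT)); first by rewrite /k probability_setT mulr1.
  by rewrite Rintegral_cst.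
pose S := [set y | eta < y / t].
have mS : measurable S.
  have md : measurable_fun setT (fun y : R => y / t) by exact: measurable_funM.
  rewrite (_ : S = (fun y => y / t) @^-1` `]eta, +oo[%classic).
    by rewrite -[X in measurable X]setTI; apply: md => //; exact: measurable_itv.
  by apply/seteqP; split => y; rewrite /S /= in_itv /= andbT.
have hC : `|h| <= C by exact: (expect_norm _ mF F0 FC).
have fC y : `|f y| <= C by exact: (expect_norm _ mF F0 FC).
have dist : `|\int[k]_y (cst h) y - \int[k]_y f y| <= c + C * \int[k]_y (\1_S : R -> R) y.
  apply: (Rintegral_dist k (C := Num.max C 1)) => // y.
  - by rewrite le_max hC.
  - by rewrite le_max fC.
  - by rewrite le_max indicE; case: (y \in S); rewrite ?normr1 ?normr0 ?lexx ?ler01 ?orbT.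
  - rewrite indicE; case: (boolP (y \in S)) => yS.
      rewrite mulr1 (le_trans _ (_ : C <= c + C)) ?lerDr ?(ltW c0) //.
      by apply: ler_dist_itv; rewrite (expect_ge0 _ F0) (expect_le _ mF F0 FC).
    rewrite mulr0 addr0; apply: (AU (t, upd w e.2 (Num.max (y / t) 0))).
    split => //=; apply: etaU => //.
    rewrite ger0_norm ?le_max ?lexx ?orbT // ge_max (ltW eta0) andbT leNgt.
    by apply: contra yS => yS; rewrite inE.
have massS : \int[k]_y (\1_S : R -> R) y <= c.
  rewrite /Rintegral integral_indic // setIT -lee_fin fineK; last exact: pker_fin_num.
  by rewrite /k /klaw mulrC; apply: Kt; rewrite normr_ge0.
rewrite GE [X in `|X - _|]hE (le_trans dist) // (_ : ep = c + C * c).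
  by rewrite lerD2l ler_wpM2l.
by rewrite /c -[X in X + _]mul1r -mulrDl mulrC divfK // gt_eqF // ltr_pwDl.
Qed.

Lemma scaled_cvg s (W : {set V}) z : u \in W -> tree_order E u W s -> good W z ->
  G s (scale i.1 (absv i.2)) @[i --> at_oo z] --> Gl s (absv z).
Proof.
elim: s W z => [|e s IH] W z uW /=.
  by move=> _ Wz; apply: base_cvg; apply: Wz => //; exact: pos_node_root.
case/and4P => eu aW bW sW Wz.
have IHs z' : good (e.2 |: W) z' ->
    G s (scale i.1 (absv i.2)) @[i --> at_oo z'] --> Gl s (absv z').
  by apply: IH => //; rewrite finset.in_setU1 uW orbT.
have [za|za] := eqVneq (z e.1) 0.
  exact: (step_cvg_zero eu aW IHs Wz za).
exact: (step_cvg_pos eu aW IHs Wz za).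
Qed.

Lemma cond_law_cvg : (\int[cond_law K E u t]_x (F x)%:E)%E @[t --> +oo] -->
  (\int[cond_law (limit_kernel mu) E u 1%R]_x (F x)%:E)%E.
Proof.
rewrite (integral_cond_law (limit_kernel mu) mF F0 FC).
(* The all-ones vector has no zero coordinate, so it is good for every set, and [t] times it is the
   initial vector of [cond_law]. *)
have := scaled_cvg (finset.set11 u) (tree_order_ordered_edges treeE u)
  (z := (fun=> 1) : rvec V R).
rewrite (_ : absv _ = fun=> 1); last by apply/funext => v; rewrite /absv normr1.
move=> /(_ (fun _ _ _ => oner_neq0 R)) lim.
apply: cvg_EFin; first by apply: nearW => t; rewrite (integral_cond_law K mF F0 FC).
have -> : fine \o (fun t => \int[cond_law K E u t]_x (F x)%:E)%E =
    (fun i => G (ordered_edges_from E u) (scale i.1 (absv i.2))) \o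
    (fun t : R => (t, (fun=> 1) : rvec V R)).
  apply/funext => t /=; rewrite (integral_cond_law K mF F0 FC) /=; congr (expect _ _ _ _).
  by apply/funext => v; rewrite /scale /absv normr1 mulr1.
have tp : (t, (fun=> 1) : rvec V R) @[t --> +oo] --> at_oo ((fun=> 1) : rvec V R).
  by apply: cvg_at_oo; [exact: cvg_id|exact: cvg_cst].
exact: (cvg_comp _ _ tp lim).
Qed.

End scaling_limit.

(** * Division by the root coordinate *)

Lemma measurable_invr (R : realType) : measurable_fun setT (fun x : R => x^-1).
Proof.
rewrite -(setUv [set 0]); apply/measurable_funU => //; first exact: measurableC.
split; first exact: measurable_fun_set1.
apply: open_continuous_measurable_fun.
  rewrite (_ : [set~ 0] = [set x | x != 0]); first exact: open_neq.
  by apply/seteqP; split => x /= /eqP.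
by move=> x; rewrite inE => /eqP x0; exact: inv_continuous.
Qed.

Theorem theorem2p1 (R : realType)
    (d : measure_display) (Omega : measurableType d) (P : probability Omega R)
    (V : finType) (E : {set V * V}) (X : V -> {RV P >-> R}) (u : V)
    (K : V * V -> R.-pker R ~> R) (mu : V * V -> probability R R)
    (d' : measure_display) (Omega' : measurableType d')
    (Q : probability Omega' R) (M : V * V -> {RV Q >-> R}) :
  markov_tree E X ->
  (forall v w, 0 <= X v w) ->
  (* (i); the kernels are those of nonnegative variables: from nonnegative
     states they charge only [0, +oo[ *)
  (forall e, e \in edges_from E u ->
    [/\ cond_dist P (X e.1) (X e.2) (K e),
        forall x, 0 <= x -> K e x [set y | 0 <= y] = 1%E,
        mu e [set y | 0 <= y] = 1%E &
        weak_cvg (fun x => pushforward (K e x) (fun y => y / x)) +oo (mu e)]) ->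
  (* (ii) *)
  (forall e, e \in edges_from E u -> e.1 != u ->
    (exists2 e', e' \in tree_path E u e.1 & (0 < mu e' [set 0%R])%E) ->
    forall eta : R, 0 < eta ->
      limf_esup (fun x : R => ereal_sup
          [set K e (eps * x) [set y | eta < y / x] | eps in [set eps | 0 <= eps <= delta]]) +oo
        @[delta --> 0^'+] --> 0%E) ->
  mutually_independent (edges_from E u) M ->
  (forall e, e \in edges_from E u -> forall B, measurable B ->
    distribution Q (M e) B = mu e B) ->
  cond_dist P (X u) (fun w => (X ^~ w : rvec V R)) (cond_law K E u) /\
  weak_cvg
    (fun t => pushforward (cond_law K E u t)
                (fun x => (fun v => x v / x u) : rvec V R))
    +oo
    (pushforward Q (theta E u M)).
Proof.
move=> mX X0 hi hii indM lawM.
have treeE : undirected_tree E by case: mX.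
split.
  apply: (@cond_dist_cond_law _ Omega R P V E u K (fun v => X v : Omega -> R) _ (linked E)) => //.
  - exact: linked1.
  - move=> W e WL eu aW bW; apply: linkedU1 => //.
    by case/(edges_fromP E u e): eu.
  - move=> W e WL eu aW bW; have [eE _] := elimT (edges_fromP E u e) eu.
    by apply: (markov_one_step mX eE) => //; case: (hi _ eu).
move=> f cf [m [_ fm]].
have fC x : `|f x| <= m + 1 by apply: fm => //; rewrite ltrDl.
pose C := m + 1; pose nrm (x : rvec V R) : rvec V R := fun v => x v / x u.
have mf : measurable_fun setT f by exact: continuous_measurable_rvec.
have mnrm : measurable_fun setT nrm.
  apply: measurable_rvec => v; apply: measurable_funM; first exact: measurable_coord.
  exact: measurableT_comp (@measurable_invr R) (@measurable_coord V R u).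
have mfn : measurable_fun setT (f \o nrm) by exact: measurableT_comp.
(* The shift makes the test function nonnegative, as required for integrating against composed
   kernels; [fnE] subtracts it again. *)
pose F x := f (nrm x) + C.
have mF : measurable_fun setT F by exact: measurable_funD.
have F0 x : 0 <= F x by have := fC (nrm x); rewrite ler_norml -/C /F => /andP[? _]; lra.
have FC x : F x <= C + C by have := fC (nrm x); rewrite ler_norml -/C /F => /andP[_ ?]; lra.
have F_scale t (z : rvec V R) : 0 < t -> F (fun v => t * z v) = F z.
  move=> t0; congr (f _ + _); apply/funext => v.
  by rewrite /nrm -mulf_div divff ?mul1r // gt_eqF.
have F_cont (z : rvec V R) : z u != 0 -> {for z, continuous F}.
  move=> zu.
  have nz : nrm x @[x --> z] --> nrm z.
    apply: (@rvec_cvg V R _ (nbhs z)) => v; apply: cvgM; first exact: coord_continuous.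
    by apply: cvgV => //; exact: coord_continuous.
  exact: (cvgD (cvg_comp _ _ nz (cf (nrm z))) (cvg_cst C)).
have lim := cond_law_cvg treeE (fun e eu => let: And4 _ h _ _ := hi e eu in h)
  (fun e eu => let: And4 _ _ h _ := hi e eu in h)
  (fun e eu => let: And4 _ _ _ h := hi e eu in h) hii mF F0 FC F_scale F_cont.
have FnC x : `|F x| <= C + C by rewrite ger0_norm.
have fnE (p : probability (rvec V R) R) :
    (\int[p]_x (f (nrm x))%:E)%E = (\int[p]_x F x - C)%:E.
  rewrite (integral_bounded p mfn (fun x => fC (nrm x))); congr (_%:E).
  rewrite (_ : C = \int[p]_x C); last first.
    transitivity (C * fine (p setT)); first by rewrite probability_setT mulr1.
    by rewrite Rintegral_cst.
  rewrite -RintegralB //; last 2 first.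
  - exact: (integrable_bounded p mF FnC).
  - exact: (integrable_bounded p (C := `|C|)).
  by apply: eq_Rintegral => x _; rewrite /F addrK.
have pushE t : (\int[pushforward (cond_law K E u t) nrm]_x (f x)%:E =
    (\int[klaw (cond_law K E u) t]_x F x - C)%:E)%E.
  rewrite -fnE (integral_pushforward mnrm) ?preimage_setT //.
  - exact/measurable_EFinP.
  - exact: (integrable_bounded (klaw (cond_law K E u) t) mfn (fun x => fC (nrm x))).
have mtheta : measurable_fun setT (theta E u M).
  by apply: measurable_rvec => v; exact: measurable_theta.
(* As [theta] is 1 at [u], it is fixed by [nrm], and the limit law gives [f] and [f \o nrm] the same
   integral. *)
have nrm_theta w : nrm (theta E u M w) = theta E u M w.
  by apply/funext => v; rewrite /nrm {2}/theta eqxx divr1.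
have thetaE : (\int[pushforward Q (theta E u M)]_x (f x)%:E =
    (\int[klaw (cond_law (limit_kernel mu) E u) 1%R]_x F x - C)%:E)%E.
  rewrite -fnE.
  transitivity (\int[image_measure Q mtheta]_x (f (nrm x))%:E)%E.
    rewrite !(integral_pushforward mtheta) ?preimage_setT //.
    - by apply: eq_integral => w _ /=; rewrite nrm_theta.
    - exact/measurable_EFinP.
    - exact: (integrable_bounded Q (measurableT_comp mfn mtheta) (fun w => fC _)).
    - exact/measurable_EFinP.
    - exact: (integrable_bounded Q (measurableT_comp mf mtheta) (fun w => fC _)).
  by apply: eq_measure_integral => B mB _; exact: theta_law.
rewrite thetaE; under eq_fun do rewrite pushE.
apply: cvg_EFin; first exact: nearW.
apply: cvgB; last exact: cvg_cst.
have FE t (k : R.-pker R ~> rvec V R) : (\int[k t]_x (F x)%:E)%E = (\int[klaw k t]_x F x)%:E.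
  exact: (integral_bounded (klaw k t) mF FnC).
by move: lim; rewrite FE => /fine_cvgP[].
Qed.
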